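(* Suppose $\ell:[0,\infty)\to(0,\infty)$ is an unboundedly increasing $C^1$-function such that the function \[ \rho\mapsto\rho\,\frac{\ell'(\rho)}{\ell(\rho)} \] is slowly varying and bounded for $\rho>0$. Then, for any $c>0$, the function \[ \gamma(s)=\exp\left(s^2\int_c^\infty\frac{\ell'(u)}{\ell(u)}\,\frac{du}{s+u}\right),\qquad|\arg(s+c)|<\pi, \] is admissible and \[ \lim_{\rho\to\infty}\frac{\log\gamma(\rho)}{\rho\log\ell(\rho)}=1 . \] If, in addition, the limit $\lim_{\rho\to\infty}\rho\,\frac{\ell'(\rho)}{\ell(\rho)}$ exists, then \[ \lim_{\rho\to\infty}\frac{\ell(\rho)}{\gamma(\rho)^{1/\rho}}=\ell(0). \]
   Context: A function $h$ on $[0,\infty)$ is called slowly varying if $\rho h'(\rho)=o(h(\rho))$ as $\rho\to\infty$. Admissible functions: let $\frac{\pi}{2}<\alpha_0\le\pi$ and $c_\gamma>0$, and let $\gamma$ be analytic and non-vanishing in the angle $\{s:|\arg(s+c_\gamma)|<\alpha_0\}$ and positive on $(-c_\gamma,+\infty)$. Using the branch of $\log\gamma$ that is real on $(-c_\gamma,+\infty)$, put $\log L(s)=\frac1s\log\gamma(s)$, i.e. $L(s)=\gamma(s)^{1/s}$, and $\varepsilon(s)=s\,\frac{L'(s)}{L(s)}$. The function $\gamma$ is called admissible if $\varepsilon$ is positive and bounded on $\mathbb{R}_+$ and (A) $\int^\infty \frac{\varepsilon(\rho)}{\rho}\,d\rho=\infty$; (B) $\rho|\varepsilon'(\rho)|=o(\varepsilon(\rho))$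 as $\rho\to\infty$; (C) for $s=\rho e^{i\theta}$, $\rho\to\infty$, one has $\varepsilon(s)=(1+o(1))\varepsilon(\rho)$, uniformly in any angle $|\theta|\le\alpha_0-\delta$, $\delta>0$. In the theorem, admissibility is understood with $\alpha_0=\pi$ and $c_\gamma=c$.
   Formalization: The last limit is proved with value ℓ(c) instead of the printed ℓ(0), which is false for c>0: for ℓ(ρ)=1+ρ and c=1 the ratio ℓ(ρ)/γ(ρ)^{1/ρ} tends to 2=ℓ(1), not to ℓ(0)=1. *)

(* Defs.v *)
From Stdlib Require Import Reals.
From Coquelicot Require Import Coquelicot.
Open Scope R_scope.

Definition Cexp (z : C) : C := (exp (Re z) * cos (Im z), exp (Re z) * sin (Im z)).

(* Principal argument, in (-PI, PI]; the value at 0 is meaningless. *)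
Definition Carg (z : C) : R :=
  if Rle_dec 0 (Im z) then acos (Re z / Cmod z) else - acos (Re z / Cmod z).

(* The angle {s : |arg (s + c)| < alpha}, whose vertex -c is excluded. *)
Definition angle (c alpha : R) (s : C) : Prop :=
  (s + RtoC c)%C <> RtoC 0 /\ Rabs (Carg (s + RtoC c)%C) < alpha.

(* All angles considered are open, so analyticity is complex
   differentiability at every point. *)
Definition analytic_on (D : C -> Prop) (f : C -> C) : Prop :=
  forall s, D s -> @ex_derive C_AbsRing C_NormedModule f s.

(* [is_domin F f g] is the library's little-o: g = o(f) along F. *)
Definition slowly_varying (h : R -> R) : Prop :=
  Rbar_locally p_infty (fun r => ex_derive h r) /\
  is_domin (Rbar_locally p_infty) h (fun r => r * Derive h r).

(* [lg] is the branch of log gam on the angle that is real on (-c, +oo);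
   since the angle is connected, [lg] is unique there. *)
Definition is_real_log_branch (alpha c : R) (gam lg : C -> C) : Prop :=
  analytic_on (angle c alpha) lg /\
  (forall s, angle c alpha s -> Cexp (lg s) = gam s) /\
  (forall x : R, - c < x -> Im (lg (RtoC x)) = 0).

Definition Lfun (lg : C -> C) (s : C) : C := Cexp (lg s / s)%C.

(* Meaningful for s <> 0 only, which is all that is used below. *)
Definition eps (lg : C -> C) (s : C) : C :=
  (s * (C_derive (Lfun lg) s / Lfun lg s))%C.

Definition admissible (alpha0 c : R) (gam : C -> C) : Prop :=
  PI / 2 < alpha0 <= PI /\
  0 < c /\
  analytic_on (angle c alpha0) gam /\
  (forall s, angle c alpha0 s -> gam s <> RtoC 0) /\
  (forall x : R, - c < x -> Im (gam (RtoC x)) = 0 /\ 0 < Re (gam (RtoC x))) /\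
  exists lg : C -> C,
    is_real_log_branch alpha0 c gam lg /\
    (forall r : R, 0 < r ->
       Im (eps lg (RtoC r)) = 0 /\ 0 < Re (eps lg (RtoC r))) /\
    (exists M : R, forall r : R, 0 < r -> Re (eps lg (RtoC r)) <= M) /\
    is_lim (fun X => RInt (fun r => Re (eps lg (RtoC r)) / r) 1 X)
      p_infty p_infty /\
    is_domin (Rbar_locally p_infty)
      (fun r => Re (eps lg (RtoC r)))
      (fun r => r * Cmod (C_derive (eps lg) (RtoC r))) /\
    (forall delta : R, 0 < delta ->
     forall eta : R, 0 < eta ->
     exists r0 : R, forall r theta : R,
       r0 < r -> Rabs theta <= alpha0 - delta ->
       Cmod (eps lg (RtoC r * Cexp (Ci * RtoC theta))%C / eps lg (RtoC r)
             - RtoC 1)%C <= eta).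

(* Continuously differentiable on [0, +oo), one-sidedly at 0; the values on
   (-oo, 0) are irrelevant. *)
Definition C1_nonneg (f : R -> R) : Prop :=
  exists f' : R -> R, forall x, 0 <= x ->
    filterlim (fun y => (f y - f x) / (y - x))
      (within (fun y => 0 <= y /\ y <> x) (locally x)) (locally (f' x)) /\
    filterlim f' (within (fun y => 0 <= y) (locally x)) (locally (f' x)).

(* "Increasing" is taken in the weak sense. *)
Definition unboundedly_increasing (f : R -> R) : Prop :=
  (forall x y, 0 <= x -> x <= y -> f x <= f y) /\
  (forall M : R, exists x, 0 <= x /\ M < f x).

(* [Derive l] agrees with the derivative of l on (0, +oo); the junk value
   at 0 is multiplied by 0. *)
Definition rho_dlog (l : R -> R) (r : R) : R := r * (Derive l r / l r).

(* Only the values of l on [c, +oo) enter, so the constant to which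
   l(r) / gamma(r)^(1/r) converges has to be l(c). *)
Definition gamma (l : R -> R) (c : R) (s : C) : C :=
  Cexp (s * s *
        RInt_gen (V := C_R_CompleteNormedModule)
          (fun u : R => RtoC (Derive l u / l u) / (s + RtoC u))%C
          (at_point c) (Rbar_locally p_infty))%C.

(* Main.v *)
(* Put [h u = u l'(u) / l(u)]. Then [log L(s)] is the integral over [u >= c] of
   [(h u / u) * s / (s + u)], and differentiating under the integral gives
   [eps(s) = s * int h u / (s + u)^2 du]. The same integral with [h] replaced by
   the constant [h r], [r = |s|], is [h r * s / (s + c) ~ h r]. Potter's bound
   for the slowly varying function [h] makes the difference of the two
   [o(h r)], uniformly in sectors, because [|s + u|] is there comparable to
   [r + u]; hence [eps(s) ~ h r], and likewise [r eps'(r) = o(h r)].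
   For the two limits, splitting the integral of [log L(r)] at [u = r] shows
   that it differs from [ln (l r / l c)] by a bounded quantity, which tends to
   0 if [h] has a limit [a]: the contributions of [a] to the two pieces are
   [a ln 2] and [- a ln 2] up to [o(1)]. *)

Require Import Defs.
From Stdlib Require Import Reals Lra Psatz.
From Coquelicot Require Import Coquelicot.
Open Scope R_scope.

(** * Complex derivatives and the complex exponential *)

(** Two obstacles shape the estimates. Slow variation says nothing on an initial segment, and [h] is
    only known to be nonnegative, since [l] increases weakly. So Potter's bound starts at a point
    [R1] with [h R1 > 0]; below [R1] only the bound [M] is available, which costs O(1/r^2) in an
    integral that has to be o(h(r)/r). This is affordable because Potter's bound also forces r h(r)
    to infinity. The growth allowed to h(u)/h(r) is (u/r)^(1/2) or its inverse: an exponent below 1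
    is integrable against (r + u)^(-2), and 1/2 has an arctangent primitive. For the derivative,
    eps'(r) has the kernel (u - r)/(r + u)^3. Its size is again (r + u)^(-2), but its integral is
    c/(r + c)^2 instead of being of order 1/r; this cancellation makes r eps'(r) smaller than h(r).
    Dominated convergence is replaced by explicit primitives of majorants, and differentiation under
    the integral by a quadratic remainder that is integrated over [u]. *)

Definition is_Cderive (f : C -> C) (z l : C) : Prop :=
  @is_derive C_AbsRing C_NormedModule f z l.

(** A quadratic remainder is easier to transport than a little-o: with a constant uniform in a
    parameter it survives integration over that parameter. The derivatives of [Cexp], of [Cinv] and
    of the integrals are all obtained this way. *)
Lemma is_Cderive_intro (f : C -> C) (z l : C) (eta A : R) :
  0 < eta ->
  (forall s, Cmod (s - z)%C < eta ->
     Cmod (f s - f z - (s - z) * l)%C <= A * Cmod (s - z)%C ^ 2) ->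
  is_Cderive f z l.
Proof.
intros Heta H.
split; [exact (is_linear_scal_l l)|].
intros x Hx.
assert (E0 := is_filter_lim_locally_unique
  (V := AbsRing_NormedModule C_AbsRing) z x Hx); subst x.
intros eps.
assert (Hd : 0 < Rmin eta (eps / (Rabs A + 1))).
{ apply Rmin_glb_lt; trivial.
  apply Rdiv_lt_0_compat; [apply eps|generalize (Rabs_pos A); lra]. }
exists (mkposreal _ Hd); intros y Hy.
change (Cmod (y - z)%C < Rmin eta (eps / (Rabs A + 1))) in Hy.
change (Cmod (f y - f z - (y - z) * l)%C <= eps * Cmod (y - z)%C).
assert (Hy1 := Rlt_le_trans _ _ _ Hy (Rmin_l _ _)).
assert (Hy2 := Rlt_le_trans _ _ _ Hy (Rmin_r _ _)).
eapply Rle_trans; [apply H; trivial|].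
assert (H0 := Cmod_ge_0 (y - z)%C).
assert (HA := Rabs_pos A). assert (HA' := Rle_abs A).
apply Rmult_lt_compat_r with (r := Rabs A + 1) in Hy2; [|lra].
unfold Rdiv in Hy2. rewrite Rmult_assoc, Rinv_l in Hy2; nra.
Qed.

Lemma is_Cderive_C_derive f z l : is_Cderive f z l -> C_derive f z = l.
Proof. intros H; apply is_C_derive_unique. exact H. Qed.

Lemma is_Cderive_ext_loc f g z l eta :
  0 < eta -> (forall s, Cmod (s - z)%C < eta -> f s = g s) ->
  is_Cderive f z l -> is_Cderive g z l.
Proof.
intros He H; apply is_derive_ext_loc.
exists (mkposreal _ He); intros y Hy; apply H; exact Hy.
Qed.

(* [is_linear] has the uniform structure of the target among its parameters,
   so the two structures on C are not interchangeable by conversion. *)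
Lemma is_Cderive_AbsRing f z l :
  is_Cderive f z l <->
  @is_derive C_AbsRing (AbsRing_NormedModule C_AbsRing) f z l.
Proof.
split; intros [_ H]; (split; [apply is_linear_scal_l|exact H]).
Qed.

Lemma is_Cderive_mult f g z df dg :
  is_Cderive f z df -> is_Cderive g z dg ->
  is_Cderive (fun s => f s * g s)%C z (df * g z + f z * dg)%C.
Proof.
intros Hf%is_Cderive_AbsRing Hg%is_Cderive_AbsRing.
apply is_Cderive_AbsRing, (is_derive_mult (K := C_AbsRing) f g z df dg Hf Hg).
exact Cmult_comm.
Qed.

Lemma is_Cderive_comp f g z df dg :
  is_Cderive f (g z) df -> is_Cderive g z dg ->
  is_Cderive (fun s => f (g s)) z (dg * df)%C.
Proof.
intros Hf Hg%is_Cderive_AbsRing.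
exact (is_derive_comp (K := C_AbsRing) (V := C_NormedModule) f g z df dg Hf Hg).
Qed.

Lemma is_Cderive_id z : is_Cderive (fun s => s) z (RtoC 1).
Proof. apply is_Cderive_AbsRing. exact (is_derive_id (K := C_AbsRing) z). Qed.

(** The fundamental theorem of calculus concerns a real variable, with C as a real normed module.
    This passage lets complex primitives be used in it. *)
Lemma is_Cderive_real_axis f (r : R) l :
  is_Cderive f (RtoC r) l ->
  is_derive (V := C_R_NormedModule) (fun x : R => f (RtoC x)) r l.
Proof.
intros [_ H].
split; [apply is_linear_scal_l|].
intros x Hx.
assert (E0 := is_filter_lim_locally_unique
  (V := AbsRing_NormedModule R_AbsRing) r x Hx); subst x.
intros eps.
destruct (H (RtoC r) (fun P HP => HP) eps) as [d Hd].
exists d; intros y Hy.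
assert (E : Cmod (RtoC y - RtoC r)%C = Rabs (y - r)).
{ rewrite <- RtoC_minus, Cmod_R; reflexivity. }
assert (Hb : @ball (AbsRing_UniformSpace C_AbsRing) (RtoC r) d (RtoC y)).
{ change (Cmod (RtoC y - RtoC r)%C < d). rewrite E. exact Hy. }
specialize (Hd _ Hb).
change (Cmod (f (RtoC y) - f (RtoC r) - (RtoC y - RtoC r) * l)%C
  <= eps * Cmod (RtoC y - RtoC r)%C) in Hd.
rewrite E in Hd.
eapply Rle_trans; [|exact Hd].
rewrite Cmod_norm. right.
rewrite <- RtoC_minus, <- scal_R_Cmult. reflexivity.
Qed.

Lemma is_Cderive_Re f (r : R) l :
  is_Cderive f (RtoC r) l ->
  is_derive (fun x : R => Re (f (RtoC x))) r (Re l).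
Proof.
intros H. apply is_Cderive_real_axis in H.
exact (filterdiff_comp' (fun x : R => f (RtoC x)) (fun z : C => fst z) r _ _ H
  (filterdiff_linear _ (is_linear_fst (U := R_NormedModule) (V := R_NormedModule)))).
Qed.

Lemma Cexp_plus z w : Cexp (z + w) = (Cexp z * Cexp w)%C.
Proof.
unfold Cexp, Cmult, Re, Im; simpl.
rewrite exp_plus, cos_plus, sin_plus; f_equal; ring.
Qed.

Lemma Cexp_neq_0 z : Cexp z <> RtoC 0.
Proof.
unfold Cexp; intros H; injection H; intros H1 H2.
assert (He := exp_pos (Re z)).
assert (Hc := sin2_cos2 (Im z)); unfold Rsqr in Hc. nra.
Qed.

Lemma Cexp_real (x : R) : Cexp (RtoC x) = RtoC (exp x).
Proof.
unfold Cexp, RtoC, Re, Im; simpl. rewrite cos_0, sin_0; f_equal; ring.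
Qed.

Lemma exp_sub_one_sub_le x : Rabs x <= 1 -> Rabs (exp x - 1 - x) <= x ^ 2.
Proof.
intros Hx.
assert (H1 := exp_ineq1_le x).
rewrite Rabs_pos_eq by lra.
destruct (Rle_lt_dec x 0) as [H0|H0].
- assert (H2 := exp_ineq1_le (- x)). rewrite exp_Ropp in H2.
  assert (He := exp_pos x).
  assert (H3 : exp x * (1 - x) <= 1).
  { apply Rmult_le_compat_l with (r := exp x) in H2; [|lra].
    rewrite Rinv_r in H2; nra. }
  assert (exp x <= 1 + x + x ^ 2); [|lra].
  apply Rmult_le_reg_r with (1 - x); [lra|]. nra.
- assert (Hx' : x <= 1) by (rewrite Rabs_pos_eq in Hx; lra).
  (* exp(-y) (1 + y + y^2) is 1 at 0 and has derivative exp(-y) (y - y^2) >= 0 on [0, 1], so exp x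
     <= 1 + x + x^2 there. *)
  destruct (MVT_gen (fun y => exp (- y) * (1 + y + y ^ 2)) 0 x
    (fun y => exp (- y) * (y - y ^ 2))) as [y [Hy Hd]].
  + intros y _. auto_derive; trivial. ring.
  + intros y _. apply continuity_pt_filterlim.
    apply (ex_derive_continuous (V := R_NormedModule)
             (fun y => exp (- y) * (1 + y + y ^ 2))).
    auto_derive; trivial.
  + rewrite Rmin_left, Rmax_right in Hy by lra.
    rewrite Ropp_0, exp_0 in Hd.
    assert (0 <= exp (- y) * (y - y ^ 2) * (x - 0)).
    { apply Rmult_le_pos; [apply Rmult_le_pos|lra].
      left; apply exp_pos. nra. }
    assert (H5 : 1 <= exp (- x) * (1 + x + x ^ 2)) by nra.
    rewrite exp_Ropp in *. assert (He := exp_pos x).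
    apply Rmult_le_compat_l with (r := exp x) in H5; [|lra].
    rewrite <- Rmult_assoc, Rinv_r in H5; nra.
Qed.

(** Real and imaginary part of the remainder are at most 5 m^2 with m = |w|; the modulus is at most
    sqrt 2 times the larger one. With sqrt 2 <= 2 this gives 10, which is rounded up to 12. *)
Lemma Cexp_sub_one_sub_le w : Cmod w <= 1 ->
  Cmod (Cexp w - 1 - w)%C <= 12 * Cmod w ^ 2.
Proof.
intros Hw.
assert (Hm := Rmax_Cmod w).
assert (Hx := Rle_trans _ _ _ (Rmax_l _ _) Hm).
assert (Hy := Rle_trans _ _ _ (Rmax_r _ _) Hm).
destruct w as [x y]; simpl in Hx, Hy.
set (m := Cmod (x, y)) in *.
assert (Ex := exp_sub_one_sub_le x ltac:(lra)).
assert (E1 : Rabs (exp x - 1) <= 2 * m).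
{ replace (exp x - 1) with ((exp x - 1 - x) + x) by ring.
  eapply Rle_trans; [apply Rabs_triang|].
  rewrite <- (pow2_abs x) in Ex. generalize (Rabs_pos x); intros. nra. }
assert (E2 : exp x <= 3).
{ apply Rabs_le_between in E1; lra. }
assert (Ec : Rabs (cos y - 1) <= m ^ 2).
{ destruct (MVT_gen cos 0 y (fun t => - sin t)) as [t [Ht Hd]].
  - intros t _. auto_derive; trivial. ring.
  - intros t _. apply continuity_cos.
  - rewrite cos_0 in Hd. rewrite Hd.
    rewrite Rabs_mult, Rabs_Ropp, Rminus_0_r.
    assert (Rabs t <= Rabs y).
    { revert Ht; unfold Rmin, Rmax, Rabs.
      repeat destruct Rle_dec; repeat destruct Rcase_abs; lra. }
    assert (Rabs (sin t) <= Rabs t).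
    { destruct (MVT_gen sin 0 t cos) as [v [Hv Hs]].
      - intros v _. auto_derive; trivial. ring.
      - intros v _. apply continuity_sin.
      - rewrite sin_0, !Rminus_0_r in Hs. rewrite Hs, Rabs_mult.
        assert (Rabs (cos v) <= 1) by (apply Rabs_le, COS_bound).
        generalize (Rabs_pos t); nra. }
    generalize (Rabs_pos t) (Rabs_pos (sin t)); intros; nra. }
assert (Es : Rabs (sin y - y) <= m ^ 2).
{ destruct (MVT_gen (fun t => sin t - t) 0 y (fun t => cos t - 1))
    as [t [Ht Hd]].
  - intros t _. auto_derive; trivial. ring.
  - intros t _. apply continuity_pt_filterlim.
    apply (ex_derive_continuous (V := R_NormedModule) (fun y => sin y - y)).
    auto_derive; trivial.
  - rewrite sin_0, !Rminus_0_r in Hd. rewrite Hd, Rabs_mult.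
    assert (Rabs t <= Rabs y).
    { revert Ht; unfold Rmin, Rmax, Rabs.
      repeat destruct Rle_dec; repeat destruct Rcase_abs; lra. }
    assert (Rabs (cos t - 1) <= Rabs t).
    { destruct (MVT_gen cos 0 t (fun v => - sin v)) as [v [Hv Hs]].
      - intros v _. auto_derive; trivial. ring.
      - intros v _. apply continuity_cos.
      - rewrite cos_0, !Rminus_0_r in Hs. rewrite Hs, Rabs_mult, Rabs_Ropp.
        assert (Rabs (sin v) <= 1) by (apply Rabs_le, SIN_bound).
        generalize (Rabs_pos t); nra. }
    generalize (Rabs_pos t) (Rabs_pos (cos t - 1)); intros; nra. }
assert (Hpos := exp_pos x).
assert (Hm0 : 0 <= m) by apply Cmod_ge_0.
assert (A1 : Rabs (exp x * cos y - 1 - x) <= 4 * m ^ 2).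
{ replace (exp x * cos y - 1 - x)
    with ((exp x - 1 - x) + exp x * (cos y - 1)) by ring.
  eapply Rle_trans; [apply Rabs_triang|].
  rewrite Rabs_mult, (Rabs_pos_eq (exp x)) by lra.
  rewrite <- (pow2_abs x) in Ex.
  generalize (Rabs_pos x) (Rabs_pos (cos y - 1)); intros. nra. }
assert (A2 : Rabs (exp x * sin y - y) <= 5 * m ^ 2).
{ replace (exp x * sin y - y)
    with (exp x * (sin y - y) + y * (exp x - 1)) by ring.
  eapply Rle_trans; [apply Rabs_triang|].
  rewrite !Rabs_mult, (Rabs_pos_eq (exp x)) by lra.
  generalize (Rabs_pos y) (Rabs_pos (sin y - y)) (Rabs_pos (exp x - 1));
    intros. nra. }
eapply Rle_trans; [apply Cmod_2Rmax|].
assert (Hs2 : sqrt 2 <= 2).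
{ rewrite <- (sqrt_Rsqr 2) at 2 by lra. apply sqrt_le_1_alt.
  unfold Rsqr; lra. }
assert (Hr : Rmax (Rabs (fst (Cexp (x, y) - 1 - (x, y))%C))
                  (Rabs (snd (Cexp (x, y) - 1 - (x, y))%C)) <= 5 * m ^ 2).
{ apply Rmax_lub.
  - eapply Rle_trans; [|eapply Rle_trans; [apply A1|nra]].
    right; f_equal; unfold Cexp, Re, Im; simpl; ring.
  - eapply Rle_trans; [|apply A2].
    right; f_equal; unfold Cexp, Re, Im; simpl; ring. }
assert (0 <= sqrt 2) by apply sqrt_pos.
apply Rle_trans with (2 * (5 * m ^ 2)); [|nra].
apply Rmult_le_compat; trivial.
eapply Rle_trans; [apply Rabs_pos|apply Rmax_l].
Qed.

Lemma is_Cderive_Cexp z : is_Cderive Cexp z (Cexp z).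
Proof.
apply (is_Cderive_intro _ _ _ 1 (12 * Cmod (Cexp z))); [lra|].
intros s Hs.
replace (Cexp s - Cexp z - (s - z) * Cexp z)%C
  with (Cexp z * (Cexp (s - z) - 1 - (s - z)))%C.
- rewrite Cmod_mult.
  assert (H := Cexp_sub_one_sub_le (s - z)%C ltac:(lra)).
  assert (H0 := Cmod_ge_0 (Cexp z)). nra.
- replace (Cexp s) with (Cexp z * Cexp (s - z))%C.
  ring. rewrite <- Cexp_plus. f_equal. ring.
Qed.

(** * Improper integrals of complex-valued functions *)

Definition is_Cint (c : R) (f : R -> C) (I : C) : Prop :=
  is_RInt_gen (V := C_R_NormedModule) f (at_point c) (Rbar_locally p_infty) I.

Lemma is_Cint_iff c f I :
  is_Cint c f I <->
  forall eps : posreal, exists X0, forall X, X0 < X ->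
    exists J, is_RInt (V := C_R_NormedModule) f c X J /\ ball I eps J.
Proof.
split.
- intros H eps.
  destruct (H (fun y => ball I eps y)) as [Q P HQ [X0 HP] HQP].
  { exists eps; trivial. }
  exists X0; intros X HX.
  apply (HQP c X HQ (HP X HX)).
- intros H P [eps HP].
  destruct (H eps) as [X0 HX0].
  apply (Filter_prod _ _ _ (fun a => a = c) (fun X => X0 < X)).
  + reflexivity.
  + exists X0; trivial.
  + intros a X -> HX. destruct (HX0 X HX) as [J [HJ HB]].
    exists J; split; trivial. apply HP, HB.
Qed.

Lemma RInt_gen_Cint c f I : is_Cint c f I ->
  RInt_gen (V := C_R_CompleteNormedModule) f
    (at_point c) (Rbar_locally p_infty) = I.
Proof.
intros H.
assert (E := is_RInt_gen_unique (V := C_R_CompleteNormedModule) f I H).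
exact E.
Qed.

Lemma is_Cint_ext c f g I : (forall u, c <= u -> f u = g u) ->
  is_Cint c f I -> is_Cint c g I.
Proof.
intros H.
refine (is_RInt_gen_ext (V := C_R_NormedModule) (Fa := at_point c)
  (Fb := Rbar_locally p_infty) f g I _).
apply (Filter_prod _ _ _ (fun a => a = c) (fun X => c < X)).
- reflexivity.
- exists c; trivial.
- intros a X -> HX u Hu; simpl in Hu.
  apply H. rewrite Rmin_left in Hu; lra.
Qed.

Lemma is_Cint_plus c f g I J : is_Cint c f I -> is_Cint c g J ->
  is_Cint c (fun u => f u + g u)%C (I + J)%C.
Proof. exact (is_RInt_gen_plus (V := C_R_NormedModule) f g I J). Qed.

Lemma is_Cint_minus c f g I J : is_Cint c f I -> is_Cint c g J ->
  is_Cint c (fun u => f u - g u)%C (I - J)%C.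
Proof. exact (is_RInt_gen_minus (V := C_R_NormedModule) f g I J). Qed.

Lemma continuous_C {T : UniformSpace} (f : T -> C) (u : T) :
  continuous (fun x => Re (f x)) u -> continuous (fun x => Im (f x)) u ->
  continuous f u.
Proof.
intros H1 H2 P [eps HP].
assert (L1 := H1 _ (locally_ball (Re (f u)) eps)).
assert (L2 := H2 _ (locally_ball (Im (f u)) eps)).
unfold filtermap in *.
generalize (filter_and _ _ L1 L2); apply filter_imp.
intros x [B1 B2]. apply HP. split; trivial.
Qed.

Lemma continuous_Re {T : UniformSpace} (f : T -> C) (u : T) :
  continuous f u -> continuous (fun x => Re (f x)) u.
Proof.
intros H. apply (continuous_comp f (fun z : C => fst z)); trivial.
apply continuous_fst.
Qed.

Lemma continuous_Im {T : UniformSpace} (f : T -> C) (u : T) :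
  continuous f u -> continuous (fun x => Im (f x)) u.
Proof.
intros H. apply (continuous_comp f (fun z : C => snd z)); trivial.
apply continuous_snd.
Qed.

Lemma continuous_RtoC {T : UniformSpace} (h : T -> R) u :
  continuous h u -> continuous (fun x => RtoC (h x)) u.
Proof.
intros H; apply continuous_C; simpl; trivial. apply continuous_const.
Qed.

Lemma continuous_Cplus {T : UniformSpace} (f g : T -> C) u :
  continuous f u -> continuous g u -> continuous (fun x => f x + g x)%C u.
Proof.
intros Hf Hg; apply continuous_C.
- apply (continuous_plus (V := R_NormedModule) (fun x => Re (f x))
    (fun x => Re (g x))); apply continuous_Re; trivial.
- apply (continuous_plus (V := R_NormedModule) (fun x => Im (f x))
    (fun x => Im (g x))); apply continuous_Im; trivial.
Qed.

Lemma continuous_Cmult {T : UniformSpace} (f g : T -> C) u :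
  continuous f u -> continuous g u -> continuous (fun x => f x * g x)%C u.
Proof.
intros Hf Hg; apply continuous_C.
- apply (continuous_minus (V := R_NormedModule) (fun x => Re (f x) * Re (g x))
    (fun x => Im (f x) * Im (g x)));
  apply (continuous_mult (K := R_AbsRing)); auto using @continuous_Re, @continuous_Im.
- apply (continuous_plus (V := R_NormedModule) (fun x => Re (f x) * Im (g x))
    (fun x => Im (f x) * Re (g x)));
  apply (continuous_mult (K := R_AbsRing)); auto using @continuous_Re, @continuous_Im.
Qed.

Lemma continuous_Cinv {T : UniformSpace} (f : T -> C) u :
  f u <> RtoC 0 -> continuous f u -> continuous (fun x => / f x)%C u.
Proof.
intros H0 Hf.
assert (Hre := continuous_Re _ _ Hf).
assert (Him := continuous_Im _ _ Hf).
assert (Hn : continuous (fun x => / (Re (f x) ^ 2 + Im (f x) ^ 2)) u).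
{ apply (continuous_comp (fun x => Re (f x) ^ 2 + Im (f x) ^ 2) Rinv).
  - apply (continuous_plus (V := R_NormedModule)); simpl;
    apply (continuous_mult (K := R_AbsRing)); trivial;
    apply (continuous_mult (K := R_AbsRing)); trivial;
    apply continuous_const.
  - apply continuous_Rinv. intros E. apply H0.
    destruct (f u) as [a b]; unfold Re, Im in E; simpl in E.
    assert (a = 0) by nra. assert (b = 0) by nra. subst; reflexivity. }
apply continuous_C.
- apply (continuous_mult (K := R_AbsRing) (fun x => Re (f x))); trivial.
- apply (continuous_mult (K := R_AbsRing) (fun x => - Im (f x))); trivial.
  apply (continuous_opp (V := R_NormedModule)); trivial.
Qed.

(** The integral takes values in C as a real module, so a complex factor is not a scalar; the real
    and imaginary parts are treated separately. *)
Lemma is_RInt_Cmult (z : C) (f : R -> C) a b (I : C) :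
  is_RInt (V := C_R_NormedModule) f a b I ->
  is_RInt (V := C_R_NormedModule) (fun u => z * f u)%C a b (z * I)%C.
Proof.
intros H.
assert (H1 := is_RInt_fct_extend_fst
  (U := R_NormedModule) (V := R_NormedModule) f a b I H).
assert (H2 := is_RInt_fct_extend_snd
  (U := R_NormedModule) (V := R_NormedModule) f a b I H).
apply (is_RInt_fct_extend_pair (U := R_NormedModule) (V := R_NormedModule)); simpl.
- apply (is_RInt_minus (V := R_NormedModule));
  apply (is_RInt_scal (V := R_NormedModule)); trivial.
- apply (is_RInt_plus (V := R_NormedModule));
  apply (is_RInt_scal (V := R_NormedModule)); trivial.
Qed.

Lemma is_Cint_mult c z f I : is_Cint c f I ->
  is_Cint c (fun u => z * f u)%C (z * I)%C.
Proof.
intros H P HP.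
assert (Hc : continuous (fun y : C => z * y)%C I).
{ apply continuous_Cmult. apply continuous_const. apply continuous_id. }
specialize (H _ (Hc P HP)).
unfold filtermapi in *. revert H; apply filter_imp.
intros ab [y [Hy HPy]]. exists (z * y)%C. split; trivial.
apply is_RInt_Cmult, Hy.
Qed.

(** Balls of the product structure on C are squares; hence a factor sqrt 2, rounded up to 2. *)
Lemma Cmod_ball (I J : C) (eps : posreal) :
  @ball C_UniformSpace I eps J -> Cmod (J - I)%C < 2 * eps.
Proof.
intros [B1 B2].
change (Rabs (fst J - fst I) < eps) in B1.
change (Rabs (snd J - snd I) < eps) in B2.
eapply Rle_lt_trans; [apply Cmod_2Rmax|].
assert (Hs2 : sqrt 2 < 2).
{ rewrite <- (sqrt_Rsqr 2) at 2 by lra. apply sqrt_lt_1_alt.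
  unfold Rsqr; lra. }
assert (0 <= sqrt 2) by apply sqrt_pos.
assert (Rmax (Rabs (fst (J - I)%C)) (Rabs (snd (J - I)%C)) < eps)
  by (apply Rmax_lub_lt; trivial).
assert (0 <= Rmax (Rabs (fst (J - I)%C)) (Rabs (snd (J - I)%C)))
  by (eapply Rle_trans; [apply Rabs_pos|apply Rmax_l]).
nra.
Qed.

Lemma ball_Cmod (I J : C) (eps : posreal) :
  Cmod (J - I)%C < eps -> @ball C_UniformSpace I eps J.
Proof.
destruct I as [a b], J as [a' b']; intros H.
assert (Hm := Rmax_Cmod ((a', b') - (a, b))%C).
split; [change (Rabs (a' - a) < eps)|change (Rabs (b' - b) < eps)];
(eapply Rle_lt_trans; [|exact H]);
(eapply Rle_trans; [|exact Hm]); [apply Rmax_l|apply Rmax_r].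
Qed.

(* [g] is nonnegative and has a primitive [G] bounded by [B] on [c, +oo), so
   that its integral there is at most [B - G c]. *)
Definition dominator (c : R) (g G : R -> R) (B : R) : Prop :=
  forall u, c <= u ->
    0 <= g u /\ continuous g u /\ is_derive G u (g u) /\ G u <= B.

Lemma dominator_plus c g1 G1 B1 g2 G2 B2 :
  dominator c g1 G1 B1 -> dominator c g2 G2 B2 ->
  dominator c (fun u => g1 u + g2 u) (fun u => G1 u + G2 u) (B1 + B2).
Proof.
intros H1 H2 u Hu.
destruct (H1 u Hu) as (P1 & C1 & D1 & L1).
destruct (H2 u Hu) as (P2 & C2 & D2 & L2).
split; [|split; [|split]]; try lra.
- apply (continuous_plus (V := R_NormedModule)); trivial.
- apply (is_derive_plus (V := R_NormedModule)); trivial.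
Qed.

Lemma dominator_scal c a g G B : 0 <= a ->
  dominator c g G B ->
  dominator c (fun u => a * g u) (fun u => a * G u) (a * B).
Proof.
intros Ha H u Hu.
destruct (H u Hu) as (P1 & C1 & D1 & L1).
split; [|split; [|split]].
- apply Rmult_le_pos; trivial.
- apply (continuous_scal_r (V := R_NormedModule)); trivial.
- apply is_derive_scal; trivial.
- apply Rmult_le_compat_l; trivial.
Qed.

Lemma dominator_RInt c g G B X : dominator c g G B -> c <= X ->
  is_RInt g c X (G X - G c).
Proof.
intros H HX.
apply (is_RInt_derive (V := R_CompleteNormedModule) G g);
  rewrite Rmin_left, Rmax_right by trivial; intros x Hx;
  apply (H x); lra.
Qed.

Lemma dominator_le c g G B x y : dominator c g G B -> c <= x -> x <= y ->
  G x <= G y.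
Proof.
intros H Hx Hy.
assert (Hd : dominator x g G B) by (intros u Hu; apply H; lra).
assert (HI := dominator_RInt _ _ _ _ y Hd Hy).
assert (0 <= G y - G x); [|lra].
apply (is_RInt_le (fun _ => 0) g x y 0); trivial.
- assert (H0 := is_RInt_const (V := R_NormedModule) x y 0).
  unfold scal in H0; simpl in H0; unfold mult in H0; simpl in H0.
  rewrite Rmult_0_r in H0. exact H0.
- intros u Hu. apply H; lra.
Qed.

Lemma RInt_dominated c f g G B x y J : dominator c g G B ->
  (forall u, c <= u -> Cmod (f u) <= g u) -> c <= x -> x <= y ->
  is_RInt (V := C_R_NormedModule) f x y J -> Cmod J <= G y - G x.
Proof.
intros Hg Hf Hx Hy HJ.
assert (Hd : dominator x g G B) by (intros u Hu; apply Hg; lra).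
rewrite Cmod_norm.
apply (norm_RInt_le (V := C_R_NormedModule) f g x y J (G y - G x)); trivial.
- intros u Hu. specialize (Hf u ltac:(lra)). rewrite Cmod_norm in Hf. exact Hf.
- exact (dominator_RInt _ _ _ _ y Hd Hy).
Qed.

Lemma is_Cint_le c f I g G B : is_Cint c f I -> dominator c g G B ->
  (forall u, c <= u -> Cmod (f u) <= g u) -> Cmod I <= B - G c.
Proof.
intros HI Hg Hf.
apply le_epsilon; intros e He.
destruct (proj1 (is_Cint_iff c f I) HI (mkposreal (e / 2) ltac:(lra)))
  as [X0 H].
destruct (H (Rmax X0 c + 1)) as [J [HJ HB]].
{ generalize (Rmax_l X0 c); lra. }
assert (HX := Rmax_r X0 c).
assert (H1 := RInt_dominated c f g G B c (Rmax X0 c + 1) J Hg Hf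
  (Rle_refl c) ltac:(lra) HJ).
apply Cmod_ball in HB; simpl in HB.
assert (H2 := proj2 (proj2 (proj2 (Hg (Rmax X0 c + 1) ltac:(lra))))).
replace I with (J - (J - I))%C by ring.
eapply Rle_trans; [apply Cmod_triangle|]. rewrite Cmod_opp. lra.
Qed.

(** Cauchy's criterion: the integral of [f] over [x, y] is at most [G y - G x], and the monotone
    bounded [G] has small increments far out. *)
Lemma ex_Cint c f g G B : (forall u, c <= u -> continuous f u) ->
  dominator c g G B ->
  (forall u, c <= u -> Cmod (f u) <= g u) -> exists I, is_Cint c f I.
Proof.
intros Hc Hg Hf.
assert (Hex : forall x y, c <= x -> c <= y ->
  is_RInt (V := C_R_NormedModule) f x y (RInt (V := C_R_CompleteNormedModule) f x y)).
{ intros x y Hx Hy. apply (RInt_correct (V := C_R_CompleteNormedModule)).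
  apply ex_RInt_continuous. intros z Hz. apply Hc.
  revert Hz; unfold Rmin; destruct Rle_dec; lra. }
(* The limit of [G] is taken along [c + n], as that of a bounded increasing sequence; monotonicity
   then makes it an upper bound for [G] on all of [c, +oo). *)
assert (Hlim : exists l, is_lim_seq (fun n => G (c + INR n)) l /\ is_finite l).
{ destruct (ex_finite_lim_seq_incr (fun n => G (c + INR n)) B) as [l Hl].
  - intros n. apply (dominator_le c g G B); trivial.
    generalize (pos_INR n); lra. rewrite S_INR; lra.
  - intros n. apply Hg. generalize (pos_INR n); lra.
  - exists l; split; trivial. reflexivity. }
destruct Hlim as [l [Hl Hfin]].
destruct l as [l| |]; try discriminate.
assert (HGl : forall u, c <= u -> G u <= l).
{ intros u Hu.
  destruct (nfloor_ex (u - c) ltac:(lra)) as [n Hn].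
  apply Rle_trans with (G (c + INR (S n))).
  - apply (dominator_le c g G B); trivial. rewrite S_INR; lra.
  - apply (is_lim_seq_incr_compare (fun n => G (c + INR n))); trivial.
    intros m. apply (dominator_le c g G B); trivial.
    generalize (pos_INR m); lra. rewrite S_INR; lra. }
destruct (proj1 (filterlim_locally_cauchy (U := C_R_CompleteNormedModule)
   (F := Rbar_locally p_infty)
   (fun X => RInt (V := C_R_CompleteNormedModule) f c X))) as [I HI].
- intros eps.
  assert (Hs := proj2 (is_lim_seq_spec _ _) Hl eps).
  destruct Hs as [N HN]. specialize (HN N (Nat.le_refl N)).
  apply Rabs_lt_between in HN.
  assert (HcN : c <= c + INR N) by (generalize (pos_INR N); lra).
  assert (key : forall x y, c + INR N < x -> x <= y ->
    Cmod (RInt (V := C_R_CompleteNormedModule) f c y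
          - RInt (V := C_R_CompleteNormedModule) f c x)%C < eps).
  { intros x y Hx Hy.
    assert (E := RInt_Chasles (V := C_R_CompleteNormedModule) f c x y
     (ex_intro _ _ (Hex c x ltac:(lra) ltac:(lra)))
     (ex_intro _ _ (Hex x y ltac:(lra) ltac:(lra)))).
    rewrite <- E.
    replace (plus (RInt (V := C_R_CompleteNormedModule) f c x)
          (RInt (V := C_R_CompleteNormedModule) f x y)
        - RInt (V := C_R_CompleteNormedModule) f c x)%C
     with (RInt (V := C_R_CompleteNormedModule) f x y : C).
    2:{ generalize (RInt (V := C_R_CompleteNormedModule) f x y : C)
          (RInt (V := C_R_CompleteNormedModule) f c x : C).
        intros a b. change (a = (b + a) - b)%C. ring. }
    eapply Rle_lt_trans.
    { apply (RInt_dominated c f g G B x y); trivial; try lra.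
      apply Hex; lra. }
    assert (G y <= l) by (apply HGl; lra).
    assert (G (c + INR N) <= G x)
      by (apply (dominator_le c g G B); trivial; lra).
    lra. }
  exists (fun X => c + INR N < X); split.
  { exists (c + INR N); trivial. }
  intros x y Hx Hy.
  destruct (Rle_dec x y) as [Hxy|Hxy].
  + apply ball_Cmod, key; trivial.
  + apply ball_sym, ball_Cmod, key; trivial; lra.
- exists I. apply is_Cint_iff. intros eps.
  destruct (HI _ (locally_ball I eps)) as [X0 H].
  exists (Rmax X0 c). intros X HX.
  assert (H1 := Rmax_l X0 c). assert (H2 := Rmax_r X0 c).
  exists (RInt (V := C_R_CompleteNormedModule) f c X). split.
  + apply Hex; lra.
  + apply H; lra.
Qed.

Lemma dominator_inv_sqr c A : 0 < c -> 0 <= A ->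
  dominator c (fun u => A / u ^ 2) (fun u => - (A / u)) 0.
Proof.
intros Hc HA u Hu.
assert (0 <= A / u) by (apply Rdiv_le_0_compat; lra).
split; [|split; [|split]].
- apply Rdiv_le_0_compat; nra.
- apply (ex_derive_continuous (V := R_NormedModule)). auto_derive. nra.
- auto_derive. lra. field; lra.
- lra.
Qed.

(** Differentiation under the integral sign: the pointwise remainder carries the integrable weight
    1/u^2, whose integral from [c] is 1/c, so the integrated remainder is still quadratic in |s -
    z|. *)
Lemma is_Cderive_Cint c (f : C -> R -> C) (f' : R -> C) (F : C -> C) z l eta A :
  0 < c -> 0 < eta -> 0 <= A ->
  (forall s, Cmod (s - z)%C < eta -> is_Cint c (f s) (F s)) ->
  is_Cint c f' l ->
  (forall s u, Cmod (s - z)%C < eta -> c <= u ->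
     Cmod (f s u - f z u - (s - z) * f' u)%C
       <= A * Cmod (s - z)%C ^ 2 / u ^ 2) ->
  is_Cderive F z l.
Proof.
intros Hc Heta HA HF Hl H.
apply (is_Cderive_intro _ _ _ eta (A / c)); trivial.
intros s Hs.
assert (Hz : is_Cint c (f z) (F z)).
{ apply HF. replace (z - z)%C with (RtoC 0) by ring. rewrite Cmod_0; trivial. }
assert (HI := is_Cint_minus _ _ _ _ _
  (is_Cint_minus _ _ _ _ _ (HF s Hs) Hz) (is_Cint_mult _ (s - z)%C _ _ Hl)).
assert (HA' : 0 <= A * Cmod (s - z)%C ^ 2)
  by (apply Rmult_le_pos; trivial; apply pow2_ge_0).
eapply Rle_trans.
{ apply (is_Cint_le _ _ _ _ _ _ HI (dominator_inv_sqr c _ Hc HA')).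
  intros u Hu. apply H; trivial. }
right; field; lra.
Qed.

Lemma is_Cint_Re_lim c f I : (forall u, c <= u -> continuous f u) ->
  is_Cint c f I ->
  is_lim (fun X => RInt (fun u => Re (f u)) c X) p_infty (Re I).
Proof.
intros Hc HI.
apply is_lim_spec. intros eps.
destruct (proj1 (is_Cint_iff c f I) HI eps) as [X0 H].
exists X0; intros X HX. destruct (H X HX) as [J [HJ [HB _]]].
replace (RInt (fun u => Re (f u)) c X) with (Re J).
exact HB.
symmetry; apply is_RInt_unique.
exact (is_RInt_fct_extend_fst
  (U := R_NormedModule) (V := R_NormedModule) f c X J HJ).
Qed.

Lemma is_Cint_Im_0 c f I : (forall u, c <= u -> Im (f u) = 0) ->
  is_Cint c f I -> Im I = 0.
Proof.
intros Hf HI.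
assert (H : forall e, 0 < e -> Rabs (Im I) < e).
{ intros e He.
  destruct (proj1 (is_Cint_iff c f I) HI (mkposreal e He)) as [X0 H].
  destruct (H (Rmax X0 c + 1)) as [J [HJ [_ HB]]].
  { generalize (Rmax_l X0 c); lra. }
  assert (HX := Rmax_r X0 c).
  assert (HJ2 := is_RInt_fct_extend_snd
  (U := R_NormedModule) (V := R_NormedModule) f c _ J HJ).
  assert (H0 : snd J = 0).
  { etransitivity;
      [symmetry; exact (is_RInt_unique (V := R_CompleteNormedModule) _ _ _ _ HJ2)|].
    rewrite (RInt_ext (V := R_CompleteNormedModule) _ (fun _ => 0)).
    - rewrite RInt_const. unfold scal; simpl; unfold mult; simpl; ring.
    - rewrite Rmin_left by lra. intros u Hu. apply Hf; lra. }
  change (Rabs (snd J - snd I) < e) in HB. rewrite H0 in HB.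
  rewrite <- Rabs_Ropp. replace (- Im I) with (0 - snd I). trivial.
  unfold Im; ring. }
destruct (Req_dec (Im I) 0) as [E|E]; trivial.
specialize (H _ (Rabs_pos_lt _ E)). lra.
Qed.

(** * Slowly varying functions *)

Lemma exp_le x y : x <= y -> exp x <= exp y.
Proof.
intros [H|H]; [left; apply exp_increasing; trivial|rewrite H; apply Rle_refl].
Qed.

Lemma continuous_div (f g : R -> R) u : g u <> 0 ->
  continuous f u -> continuous g u -> continuous (fun x => f x / g x) u.
Proof.
intros H0 Hf Hg.
apply (continuous_mult (K := R_AbsRing) f (fun x => / g x)); trivial.
apply (continuous_comp g Rinv); trivial.
apply continuous_Rinv; trivial.
Qed.

(** A neighbourhood of radius below x > 0 stays inside [0, +oo), where the one-sided conditions are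
    ordinary ones. *)
Lemma C1_nonneg_Derive l x : C1_nonneg l -> 0 < x ->
  ex_derive l x /\ continuous (Derive l) x.
Proof.
intros [f' H] Hx.
assert (HD : forall y, 0 < y -> is_derive l y (f' y)).
{ intros y Hy. apply is_derive_Reals. intros e He.
  destruct (H y ltac:(lra)) as [H1 _].
  destruct (H1 _ (locally_ball (f' y) (mkposreal e He))) as [d Hd].
  assert (Hm : 0 < Rmin d y) by (apply Rmin_glb_lt; [apply d|trivial]).
  exists (mkposreal _ Hm); intros t Ht0 Ht; simpl in Ht.
  assert (Ht1 := Rlt_le_trans _ _ _ Ht (Rmin_l _ _)).
  assert (Ht2 := Rlt_le_trans _ _ _ Ht (Rmin_r _ _)).
  assert (Hb : ball y d (y + t)).
  { change (Rabs (y + t - y) < d). replace (y + t - y) with t by ring. trivial. }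
  specialize (Hd (y + t) Hb).
  apply Rabs_lt_between in Ht2.
  specialize (Hd ltac:(split; lra)).
  change (Rabs ((l (y + t) - l y) / (y + t - y) - f' y) < e) in Hd.
  replace (y + t - y) with t in Hd by ring. exact Hd. }
split; [exists (f' x); auto|].
apply (continuous_ext_loc (Derive l) f').
- exists (mkposreal x Hx). intros y Hy.
  change (Rabs (y - x) < x) in Hy. apply Rabs_lt_between in Hy.
  symmetry; apply is_derive_unique, HD; lra.
- intros P HP.
  replace (Derive l x) with (f' x) in HP
   by (symmetry; apply is_derive_unique, HD; lra).
  destruct (H x ltac:(lra)) as [_ H2].
  destruct (H2 P HP) as [d Hd].
  assert (Hm : 0 < Rmin d x) by (apply Rmin_glb_lt; [apply d|trivial]).
  exists (mkposreal _ Hm); intros y Hy.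
  change (Rabs (y - x) < Rmin d x) in Hy.
  assert (Hy2 := Rlt_le_trans _ _ _ Hy (Rmin_r _ _)).
  apply Rabs_lt_between in Hy2.
  apply Hd; [|lra]. exact (Rlt_le_trans _ _ _ Hy (Rmin_l _ _)).
Qed.

Lemma Derive_nonneg_of_increasing l x : 0 < x -> ex_derive l x ->
  (forall y z, 0 <= y -> y <= z -> l y <= l z) -> 0 <= Derive l x.
Proof.
intros Hx Hd Hl. apply Derive_correct, is_derive_Reals in Hd.
destruct (Rle_lt_dec 0 (Derive l x)) as [H|H]; trivial.
destruct (Hd (- Derive l x) ltac:(lra)) as [d H1].
assert (Hd0 := cond_pos d).
specialize (H1 (d / 2) ltac:(lra)). rewrite Rabs_pos_eq in H1 by lra.
specialize (H1 ltac:(lra)). apply Rabs_lt_between in H1.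
assert (H2 : 0 <= (l (x + d / 2) - l x) / (d / 2)).
{ apply Rdiv_le_0_compat; [|lra].
  specialize (Hl x (x + d / 2) ltac:(lra) ltac:(lra)); lra. }
lra.
Qed.

(** * Potter's bound and the majorants derived from it *)

(** Used with y = |ln u - ln r| and x = ln (h u / h r), to turn a small Lipschitz constant of the
    logarithm into a small relative error times (u/r)^(1/2) or its inverse. The chain is |x| exp |x|
    <= e y exp(y/4) together with y <= 4 exp(y/4). *)
Lemma Rabs_exp_sub_one_le x y e : 0 <= y -> 0 <= e <= / 4 -> Rabs x <= e * y ->
  Rabs (exp x - 1) <= 4 * e * exp (y / 2).
Proof.
intros Hy He Hx.
assert (H1 : Rabs (exp x - 1) <= Rabs x * exp (Rabs x)).
{ destruct (Rle_lt_dec 0 x) as [H|H].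
  - assert (H2 := exp_ineq1_le (- x)). assert (H3 := exp_ineq1_le x).
    rewrite (Rabs_pos_eq x), Rabs_pos_eq by lra.
    rewrite exp_Ropp in H2. assert (H4 := exp_pos x).
    apply Rmult_le_compat_l with (r := exp x) in H2; [|lra].
    rewrite Rinv_r in H2; nra.
  - assert (H2 := exp_ineq1_le x).
    assert (exp x < 1) by (rewrite <- exp_0; apply exp_increasing; lra).
    rewrite Rabs_left, Rabs_left by lra.
    assert (1 <= exp (- x)) by (generalize (exp_ineq1_le (- x)); lra).
    nra. }
assert (H2 : exp (Rabs x) <= exp (y / 4)) by (apply exp_le; nra).
assert (H3 := exp_ineq1_le (y / 4)).
replace (exp (y / 2)) with (exp (y / 4) * exp (y / 4))
  by (rewrite <- exp_plus; f_equal; field).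
assert (H4 := exp_pos (Rabs x)). assert (H5 := Rabs_pos x).
apply Rle_trans with (e * y * exp (y / 4)).
- eapply Rle_trans; [exact H1|]. apply Rmult_le_compat; lra.
- assert (y <= 4 * exp (y / 4)) by lra.
  assert (0 <= e * exp (y / 4)) by (apply Rmult_le_pos; [lra|left; apply exp_pos]).
  nra.
Qed.

(* The integrand is [(u r)^(-1/2) / (r + u)]. *)
Lemma dominator_sqrt_kernel c r : 0 < c -> 0 < r ->
  dominator c (fun u => exp (/ 2 * (ln u - ln r)) / (u * (r + u)))
    (fun u => 2 / r * atan (exp (/ 2 * (ln u - ln r)))) (PI / r).
Proof.
intros Hc Hr u Hu.
split; [|split; [|split]].
- apply Rdiv_le_0_compat; [left; apply exp_pos|nra].
- apply (ex_derive_continuous (V := R_NormedModule)). auto_derive. 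
  split; [lra|split; trivial; nra].
- auto_derive; [lra|].
  (* With t = (u/r)^(1/2), differentiating the arctangent leaves t / (r u (1 + t^2)); the identity
     t^2 = u/r turns r (1 + t^2) into r + u. *)
  assert (E : exp (/ 2 * (ln u - ln r)) * exp (/ 2 * (ln u - ln r)) = u / r).
  { rewrite <- exp_plus.
    replace (/ 2 * (ln u - ln r) + / 2 * (ln u - ln r)) with (ln u - ln r) by field.
    unfold Rminus; rewrite exp_plus, exp_Ropp, !exp_ln by lra. reflexivity. }
  unfold Rminus in *. set (t := exp (/ 2 * (ln u + - ln r))) in *.
  rewrite Rmult_1_r, E. field. lra.
- assert (H := atan_bound (exp (/ 2 * (ln u - ln r)))).
  apply Rle_trans with (2 / r * (PI / 2)).
  + apply Rmult_le_compat_l; [|lra]. apply Rdiv_le_0_compat; lra.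
  + right; field; lra.
Qed.

(** The Potter factor is (u/r)^(1/2) above r and its inverse below r. One integrand majorises both
    cases: for u >= r by u <= r + u, for u < r by u <= (u/r) (r + u). *)
Lemma exp_half_log_ratio_le r u : 0 < r -> 0 < u ->
  exp (Rabs (ln u - ln r) / 2) / (r + u) ^ 2
    <= exp (/ 2 * (ln u - ln r)) / (u * (r + u)).
Proof.
intros Hr Hu.
assert (E : exp (/ 2 * (ln u - ln r)) * exp (/ 2 * (ln u - ln r)) = u / r).
{ rewrite <- exp_plus.
  replace (/ 2 * (ln u - ln r) + / 2 * (ln u - ln r)) with (ln u - ln r) by field.
  unfold Rminus; rewrite exp_plus, exp_Ropp, !exp_ln by lra. reflexivity. }
assert (Hp := exp_pos (/ 2 * (ln u - ln r))).
destruct (Rle_lt_dec r u) as [H|H].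
- assert (ln r <= ln u) by (apply ln_le; lra).
  rewrite Rabs_pos_eq by lra.
  replace ((ln u - ln r) / 2) with (/ 2 * (ln u - ln r)) by field.
  apply Rmult_le_compat_l; [lra|].
  apply Rinv_le_contravar; nra.
- assert (ln u < ln r) by (apply ln_increasing; lra).
  rewrite Rabs_left by lra.
  replace (- (ln u - ln r) / 2) with (- (/ 2 * (ln u - ln r))) by field.
  rewrite exp_Ropp. set (t := exp _) in *.
  apply Rmult_le_reg_r with (t * u * (r + u) ^ 2).
  { apply Rmult_lt_0_compat; [nra|]. apply pow_lt; lra. }
  replace (/ t / (r + u) ^ 2 * (t * u * (r + u) ^ 2)) with u by (field; lra).
  replace (t / (u * (r + u)) * (t * u * (r + u) ^ 2)) with (t * t * (r + u))
    by (field; lra).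
  rewrite E. replace (u / r * (r + u)) with (u + u * (u / r)) by (field; lra).
  assert (0 <= u * (u / r)) by (apply Rmult_le_pos; [lra|apply Rdiv_le_0_compat; lra]).
  lra.
Qed.

(* Potter's bound: the logarithm of a slowly varying function is Lipschitz with
   an arbitrarily small constant as a function of [ln u]. *)
Lemma slowly_varying_log_lipschitz (h : R -> R) e a :
  0 < a -> 0 <= e <= 1 -> (forall u, a <= u -> 0 <= h u) -> 0 < h a ->
  (forall u, a <= u -> ex_derive h u /\ Rabs (u * Derive h u) <= e * Rabs (h u)) ->
  (forall u, a <= u -> 0 < h u) /\
  (forall u v, a <= u -> a <= v ->
     Rabs (ln (h u) - ln (h v)) <= e * Rabs (ln u - ln v)).
Proof.
intros Ha He Hh Hpos HD.
assert (P : forall u, a <= u -> 0 < h u).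
{ intros u Hu.
  (* Logarithms need [h > 0]. The derivative of t h(t) is h + t h' >= (1 - e) h >= 0, so u h(u)
     stays above a h(a) > 0. *)
  destruct (MVT_gen (fun t => t * h t) a u (fun t => h t + t * Derive h t))
    as [t [Ht Hd]].
  - rewrite Rmin_left, Rmax_right by lra. intros t Ht.
    auto_derive; [apply HD; lra|].
    change (Derive (fun x => h x) t) with (Derive h t). ring.
  - rewrite Rmin_left, Rmax_right by lra. intros t Ht.
    apply continuity_pt_filterlim.
    apply (ex_derive_continuous (V := R_NormedModule) (fun t => t * h t)).
    auto_derive. apply HD; lra.
  - rewrite Rmin_left, Rmax_right in Ht by lra.
    destruct (HD t ltac:(lra)) as [_ H1].
    assert (H2 := Hh t ltac:(lra)). rewrite (Rabs_pos_eq (h t)) in H1 by lra.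
    apply Rabs_le_between in H1.
    assert (0 <= (h t + t * Derive h t) * (u - a)) by (apply Rmult_le_pos; nra).
    assert (0 < a * h a) by (apply Rmult_lt_0_compat; lra).
    apply Rmult_lt_reg_l with u; nra. }
split; trivial.
intros u v Hu Hv.
assert (HI : forall t, Rmin (ln v) (ln u) <= t <= Rmax (ln v) (ln u) -> a <= exp t).
{ intros t Ht. rewrite <- (exp_ln a) by lra. apply exp_le.
  assert (ln a <= ln u) by (apply ln_le; lra).
  assert (ln a <= ln v) by (apply ln_le; lra).
  revert Ht; unfold Rmin; destruct Rle_dec; lra. }
assert (Hder : forall t, Rmin (ln v) (ln u) <= t <= Rmax (ln v) (ln u) ->
  is_derive (fun t => ln (h (exp t))) t (/ h (exp t) * (exp t * Derive h (exp t)))).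
{ intros t Ht. specialize (HI t Ht). specialize (P _ HI).
  destruct (HD _ HI) as [H1 _].
  auto_derive; [split; trivial; split; trivial|].
  change (Derive (fun x => h x) (exp t)) with (Derive h (exp t)). ring. }
(* In the variable t = ln u the derivative of ln h is u h'(u) / h(u), which is at most [e] in
   absolute value. *)
destruct (MVT_gen (fun t => ln (h (exp t))) (ln v) (ln u)
   (fun t => / h (exp t) * (exp t * Derive h (exp t)))) as [t [Ht Hd]].
- intros t Ht; apply Hder; lra.
- intros t Ht. apply continuity_pt_filterlim.
  apply (ex_derive_continuous (V := R_NormedModule) (fun t => ln (h (exp t)))).
  eexists; apply Hder, Ht.
- rewrite !exp_ln in Hd by lra. rewrite Hd, Rabs_mult.
  apply Rmult_le_compat_r; [apply Rabs_pos|].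
  specialize (HI t Ht). specialize (P _ HI). destruct (HD _ HI) as [_ H1].
  rewrite (Rabs_pos_eq (h _)) in H1 by lra.
  rewrite Rabs_mult, Rabs_pos_eq by (left; apply Rinv_0_lt_compat; lra).
  apply Rmult_le_reg_l with (h (exp t)); trivial.
  rewrite <- Rmult_assoc, Rinv_r; lra.
Qed.

(* For slowly varying [h], replacing [h u] by [h r] under the integral of a
   kernel of size [(r + u)^-2] costs only [o(h r / r)]. *)
Lemma slowly_varying_kernel (h : R -> R) c M e :
  0 < c -> 0 < e -> slowly_varying h ->
  (forall u, 0 < u -> 0 <= h u <= M) ->
  (forall a, exists u, a < u /\ 0 < h u) ->
  exists r0, c <= r0 /\ forall r, r0 < r -> 0 < h r /\
    forall K f I, 0 <= K -> is_Cint c f I ->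
      (forall u, c <= u -> Cmod (f u) <= K * (Rabs (h u - h r) / (r + u) ^ 2)) ->
      Cmod I <= K * (e * h r / r).
Proof.
intros Hc He [HD1 HD2] HM Hpos.
(* 1/4 is the range of [Rabs_exp_sub_one_le]; e/(8 PI) makes the Potter part 4 e1 h(r) PI/r at most
   half of the target e h(r)/r. *)
set (e1 := Rmin (/ 4) (e / (8 * PI))).
assert (HPI := PI_RGT_0).
assert (He1 : 0 < e1 <= / 4 /\ e1 <= e / (8 * PI)).
{ unfold e1. split; [split|]; [|apply Rmin_l|apply Rmin_r].
  apply Rmin_glb_lt; [lra|]. apply Rdiv_lt_0_compat; lra. }
destruct He1 as [[He0 He1] He2].
destruct (filter_and _ _ HD1 (HD2 (mkposreal e1 He0))) as [a Ha].
destruct (Hpos (Rmax a c)) as [R1 [HR1 HhR1]].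
assert (HaR := Rle_lt_trans _ _ _ (Rmax_l a c) HR1).
assert (HcR := Rle_lt_trans _ _ _ (Rmax_r a c) HR1).
destruct (slowly_varying_log_lipschitz h e1 R1) as [P L]; try lra.
{ intros u Hu. apply HM; lra. }
{ intros u Hu. apply (Ha u); lra. }
assert (HM0 : 0 < M) by (destruct (HM R1); lra).
(* The initial segment contributes at most M R1^2 / (r^2 c). This is within the other half, e h(r) /
   (2 r), exactly when r h(r) >= T. *)
set (T := 2 * M * R1 ^ 2 / (c * e)).
assert (HT : 0 < T).
{ apply Rdiv_lt_0_compat; [|nra]. apply Rmult_lt_0_compat; [lra|].
  apply pow_lt; lra. }
(* Potter's lower bound gives ln (r h(r)) >= (1 - e1) ln r + ln h(R1) + e1 ln R1; solving for the
   right side to reach ln T yields the exponent. *)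
set (r0 := Rmax R1 (exp ((ln T - ln (h R1) - e1 * ln R1) / (1 - e1)))).
assert (H01 := Rmax_l R1 (exp ((ln T - ln (h R1) - e1 * ln R1) / (1 - e1)))).
assert (H02 := Rmax_r R1 (exp ((ln T - ln (h R1) - e1 * ln R1) / (1 - e1)))).
fold r0 in H01, H02.
exists r0. split; [lra|]. intros r Hr.
assert (Phr : 0 < h r) by (apply P; lra).
split; trivial. intros K f I HK HI Hf.
assert (HTr : T <= r * h r).
{ assert (H1 := L r R1 ltac:(lra) ltac:(lra)).
  assert (ln R1 < ln r) by (apply ln_increasing; lra).
  rewrite (Rabs_pos_eq (ln r - ln R1)) in H1 by lra.
  apply Rabs_le_between in H1.
  assert (H2 : (ln T - ln (h R1) - e1 * ln R1) / (1 - e1) <= ln r).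
  { rewrite <- (ln_exp ((ln T - ln (h R1) - e1 * ln R1) / (1 - e1))).
    apply ln_le; [apply exp_pos|lra]. }
  apply Rmult_le_compat_r with (r := 1 - e1) in H2; [|lra].
  unfold Rdiv in H2. rewrite Rmult_assoc, Rinv_l, Rmult_1_r in H2 by lra.
  rewrite <- (exp_ln T), <- (exp_ln (r * h r)) by (trivial; nra).
  apply exp_le. rewrite ln_mult by lra. nra. }
(* The first summand serves u >= R1, by Potter. The second serves c <= u <= R1, where |h u - h r| <=
   M and 1/(r + u)^2 <= 1/r^2 <= R1^2 / (r^2 u^2). Both are kept on the whole half-line. *)
assert (Hg : dominator c
  (fun u => K * (4 * e1 * h r * (exp (/ 2 * (ln u - ln r)) / (u * (r + u)))
    + M * R1 ^ 2 / r ^ 2 / u ^ 2))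
  (fun u => K * (4 * e1 * h r * (2 / r * atan (exp (/ 2 * (ln u - ln r))))
    + - (M * R1 ^ 2 / r ^ 2 / u)))
  (K * (4 * e1 * h r * (PI / r) + 0))).
{ apply dominator_scal; trivial. apply dominator_plus.
  - apply dominator_scal; [|apply dominator_sqrt_kernel; lra].
    apply Rmult_le_pos; lra.
  - apply dominator_inv_sqr; trivial. apply Rdiv_le_0_compat.
    apply Rmult_le_pos; [lra|apply pow2_ge_0]. apply pow_lt; lra. }
eapply Rle_trans.
{ apply (is_Cint_le _ _ _ _ _ _ HI Hg).
  intros u Hu. eapply Rle_trans; [apply Hf; trivial|].
  apply Rmult_le_compat_l; trivial.
  assert (Hru : 0 < (r + u) ^ 2) by (apply pow_lt; lra).
  destruct (Rle_lt_dec R1 u) as [H|H].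
  - assert (H1 : Rabs (h u - h r) <= 4 * e1 * h r * exp (Rabs (ln u - ln r) / 2)).
    { assert (H1 := Rabs_exp_sub_one_le _ _ e1 (Rabs_pos _) ltac:(lra)
                      (L u r H ltac:(lra))).
      unfold Rminus at 2 in H1.
      rewrite exp_plus, exp_Ropp, !exp_ln in H1 by (trivial; apply P; trivial).
      replace (h u - h r) with (h r * (h u * / h r - 1)) by (field; lra).
      rewrite Rabs_mult, (Rabs_pos_eq (h r)) by lra.
      apply Rmult_le_compat_l with (r := h r) in H1; lra. }
    assert (H2 := exp_half_log_ratio_le r u ltac:(lra) ltac:(lra)).
    assert (H3 : 0 <= M * R1 ^ 2 / r ^ 2 / u ^ 2).
    { apply Rdiv_le_0_compat; [|apply pow_lt; lra].
      apply Rdiv_le_0_compat; [|apply pow_lt; lra].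
      apply Rmult_le_pos; [lra|apply pow2_ge_0]. }
    assert (H4 : Rabs (h u - h r) / (r + u) ^ 2 <=
       4 * e1 * h r * (exp (Rabs (ln u - ln r) / 2) / (r + u) ^ 2)).
    { unfold Rdiv at 1 2. rewrite <- Rmult_assoc. apply Rmult_le_compat_r; trivial.
      left; apply Rinv_0_lt_compat; trivial. }
    apply Rmult_le_compat_l with (r := 4 * e1 * h r) in H2.
    lra. apply Rmult_le_pos; lra.
  - assert (H1 : Rabs (h u - h r) <= M).
    { destruct (HM u ltac:(lra)). destruct (HM r ltac:(lra)).
      apply Rabs_le; lra. }
    assert (H3 : 0 <= 4 * e1 * h r * (exp (/ 2 * (ln u - ln r)) / (u * (r + u)))).
    { apply Rmult_le_pos; [apply Rmult_le_pos; lra|].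
      apply Rdiv_le_0_compat; [left; apply exp_pos|nra]. }
    assert (H4 : Rabs (h u - h r) / (r + u) ^ 2 <= M * R1 ^ 2 / r ^ 2 / u ^ 2); [|lra].
    apply Rle_trans with (M / r ^ 2).
    + apply Rmult_le_compat; trivial. apply Rabs_pos.
      left; apply Rinv_0_lt_compat; trivial.
      apply Rinv_le_contravar; [apply pow_lt; lra|apply pow_incr; lra].
    + replace (M * R1 ^ 2 / r ^ 2 / u ^ 2) with (M / r ^ 2 * (R1 / u) ^ 2)
        by (field; lra).
      rewrite <- (Rmult_1_r (M / r ^ 2)) at 1.
      apply Rmult_le_compat_l.
      apply Rdiv_le_0_compat; [lra|apply pow_lt; lra].
      rewrite <- (pow1 2). apply pow_incr. split; [lra|].
      apply Rmult_le_reg_r with u; [lra|]. unfold Rdiv.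
      rewrite Rmult_assoc, Rinv_l; lra. }
assert (HA : 0 <= atan (exp (/ 2 * (ln c - ln r)))).
{ rewrite <- atan_0. left; apply atan_increasing, exp_pos. }
assert (H1 : 4 * e1 * h r * (PI / r) <= e / 2 * h r / r).
{ apply Rmult_le_compat_l with (r := 4 * (PI * h r / r)) in He2.
  replace (4 * (PI * h r / r) * (e / (8 * PI))) with (e / 2 * h r / r) in He2
    by (field; lra).
  replace (4 * e1 * h r * (PI / r)) with (4 * (PI * h r / r) * e1) by (field; lra).
  exact He2.
  apply Rmult_le_pos; [lra|]. apply Rdiv_le_0_compat; [nra|lra]. }
assert (H2 : M * R1 ^ 2 / r ^ 2 / c <= e / 2 * h r / r).
{ replace (M * R1 ^ 2 / r ^ 2 / c) with (T * (e / 2 / r ^ 2))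
    by (unfold T; field; lra).
  replace (e / 2 * h r / r) with (r * h r * (e / 2 / r ^ 2)) by (field; lra).
  apply Rmult_le_compat_r; trivial. apply Rdiv_le_0_compat; [lra|apply pow_lt; lra]. }
assert (H3 : 0 <= 4 * e1 * h r * (2 / r * atan (exp (/ 2 * (ln c - ln r))))).
{ apply Rmult_le_pos; [apply Rmult_le_pos; lra|].
  apply Rmult_le_pos; trivial. apply Rdiv_le_0_compat; lra. }
rewrite <- Rmult_minus_distr_l. apply Rmult_le_compat_l; trivial.
replace (e * h r / r) with (e / 2 * h r / r + e / 2 * h r / r) by (field; lra).
lra.
Qed.

(** * Comparison of log L with ln l on the positive axis *)

Lemma continuous_Cdiv {T : UniformSpace} (f g : T -> C) u :
  g u <> RtoC 0 -> continuous f u -> continuous g u ->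
  continuous (fun x => f x / g x)%C u.
Proof.
intros H0 Hf Hg. apply continuous_Cmult; trivial. apply continuous_Cinv; trivial.
Qed.

Lemma continuous_shift (s : C) (u : R) :
  continuous (fun x : R => s + RtoC x)%C u.
Proof.
apply continuous_Cplus; [apply continuous_const|].
apply continuous_RtoC, continuous_id.
Qed.

Lemma RInt_abs_le_antideriv (f g G : R -> R) a b :
  a <= b -> (forall u, a <= u <= b -> continuous f u) ->
  (forall u, a <= u <= b -> is_derive G u (g u) /\ continuous g u) ->
  (forall u, a <= u <= b -> Rabs (f u) <= g u) ->
  Rabs (RInt f a b) <= G b - G a.
Proof.
intros Hab Hf HG Hfg.
assert (Hg : is_RInt g a b (G b - G a)).
{ apply (is_RInt_derive (V := R_CompleteNormedModule) G g);
    rewrite Rmin_left, Rmax_right by trivial; intros x Hx; apply HG, Hx. }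
apply (norm_RInt_le (V := R_NormedModule) f g a b); trivial.
apply (RInt_correct (V := R_CompleteNormedModule)).
apply (ex_RInt_continuous (V := R_CompleteNormedModule)).
rewrite Rmin_left, Rmax_right by trivial; trivial.
Qed.

(* Here [r * Re I] is [log L(r)] and the integral is [ln (l r / l c)]. Both
   kernels, [r / (u (r + u))] and [1 / u], are split at [u = r], and the
   constant part [a] of [h] is integrated exactly. *)
Lemma Stieltjes_log_bound (h : R -> R) c a e B r I :
  0 < c -> c <= r -> 0 <= e -> 0 <= B ->
  (forall u, c <= u -> continuous h u) ->
  (forall u, c <= u -> Rabs (h u - a) <= e + B / u ^ 2) ->
  is_Cint c (fun u => RtoC (h u / u) / (RtoC r + RtoC u))%C I ->
  Rabs (r * Re I - RInt (fun u => h u / u) c r - a * ln ((r + c) / r))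
    <= 2 * e + 2 * B / (r * c).
Proof.
intros Hc Hr He HB Hh Ha HI.
assert (HRe : forall u, c <= u ->
  Re (RtoC (h u / u) / (RtoC r + RtoC u))%C = h u / (u * (r + u))).
{ intros u Hu. rewrite <- RtoC_plus, <- RtoC_div, re_RtoC by lra. field; lra. }
assert (Hc1 : forall u, c <= u -> continuous (fun u => h u / u) u).
{ intros u Hu. apply continuous_div; [lra|auto|apply continuous_id]. }
assert (Hlim : is_lim (fun X => RInt (fun u =>
  Re (RtoC (h u / u) / (RtoC r + RtoC u))%C) c X) p_infty (Re I)).
{ apply is_Cint_Re_lim; trivial. intros u Hu. apply continuous_Cdiv.
  - rewrite <- RtoC_plus. intros E; apply RtoC_inj in E; lra.
  - apply continuous_RtoC; auto.
  - apply continuous_shift. }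
assert (Hc2 : forall u, c <= u -> continuous (fun u => h u / (u * (r + u))) u).
{ intros u Hu. apply continuous_div; [nra|auto|].
  apply (ex_derive_continuous (V := R_NormedModule)). auto_derive; trivial. }
apply le_epsilon; intros d Hd.
apply is_lim_spec in Hlim.
destruct (Hlim (mkposreal (d / (2 * r)) ltac:(apply Rdiv_lt_0_compat; lra)))
  as [X0 HX0]; simpl in HX0.
(* Beyond [X0] the truncation error, multiplied by r, is below d/2; the last lower bound makes the
   leftover |a| (ln (r + X) - ln X) <= |a| r/X at most d/2 as well. *)
set (X := Rmax (Rmax X0 r) (2 * r * Rabs a / d) + 1).
assert (HXX0 : X0 < X /\ r < X /\ 2 * r * Rabs a / d < X).
{ unfold X. generalize (Rmax_l (Rmax X0 r) (2 * r * Rabs a / d))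
   (Rmax_r (Rmax X0 r) (2 * r * Rabs a / d)) (Rmax_l X0 r) (Rmax_r X0 r). lra. }
destruct HXX0 as (HX1 & HX2 & HX3).
specialize (HX0 X HX1).
rewrite (RInt_ext (V := R_CompleteNormedModule) _
  (fun u => h u / (u * (r + u)))) in HX0.
2:{ rewrite Rmin_left by lra. intros u Hu. apply HRe; lra. }
assert (ex1 : forall x y, c <= x -> c <= y -> 
  ex_RInt (fun u => h u / (u * (r + u))) x y).
{ intros x y Hx Hy. apply (ex_RInt_continuous (V := R_CompleteNormedModule)).
  intros z Hz. apply Hc2. revert Hz; unfold Rmin; destruct Rle_dec; lra. }
assert (ex2 : ex_RInt (fun u => h u / u) c r).
{ apply (ex_RInt_continuous (V := R_CompleteNormedModule)).
  rewrite Rmin_left by lra. intros z Hz. apply Hc1; lra. }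
assert (Ech := RInt_Chasles (V := R_CompleteNormedModule)
  (fun u => h u / (u * (r + u))) c r X (ex1 c r ltac:(lra) ltac:(lra))
  (ex1 r X ltac:(lra) ltac:(lra))).
change (RInt (fun u => h u / (u * (r + u))) c r
  + RInt (fun u => h u / (u * (r + u))) r X
  = RInt (fun u => h u / (u * (r + u))) c X) in Ech.
(* Below r the two kernels differ by 1/u - r/(u (r + u)) = 1/(r + u) <= 1/r, so the error e + B/u^2
   integrates to at most e + B/(r c). *)
assert (I1 : is_RInt (fun u => (h u - a) / (r + u)) c r
  (RInt (fun u => h u / u) c r - r * RInt (fun u => h u / (u * (r + u))) c r
   - a * (ln (r + r) - ln (r + c)))).
{ assert (J1 := RInt_correct (V := R_CompleteNormedModule) _ _ _ ex2).
  assert (J2 := RInt_correct (V := R_CompleteNormedModule) _ _ _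
     (ex1 c r ltac:(lra) ltac:(lra))).
  assert (J3 : is_RInt (fun u => / (r + u)) c r (ln (r + r) - ln (r + c))).
  { apply (is_RInt_derive (V := R_CompleteNormedModule) (fun u => ln (r + u)));
    rewrite Rmin_left by lra; intros x Hx.
    - auto_derive; [lra|]. field; lra.
    - apply (ex_derive_continuous (V := R_NormedModule)). auto_derive. lra. }
  apply (is_RInt_scal (V := R_NormedModule) _ _ _ r) in J2.
  apply (is_RInt_scal (V := R_NormedModule) _ _ _ a) in J3.
  assert (J := is_RInt_minus (V := R_NormedModule) _ _ _ _ _ _
    (is_RInt_minus (V := R_NormedModule) _ _ _ _ _ _ J1 J2) J3).
  apply (is_RInt_ext (V := R_NormedModule)) with (2 := J).
  rewrite Rmin_left by lra. intros u Hu.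
  change (h u / u - r * (h u / (u * (r + u))) - a * / (r + u)
   = (h u - a) / (r + u)). field; lra. }
assert (B1 : Rabs (RInt (fun u => h u / u) c r
   - r * RInt (fun u => h u / (u * (r + u))) c r
   - a * (ln (r + r) - ln (r + c))) <= e + B / (r * c)).
{ rewrite <- (is_RInt_unique (V := R_CompleteNormedModule) _ _ _ _ I1).
  eapply Rle_trans.
  { apply (RInt_abs_le_antideriv _ (fun u => e / r + B / r / u ^ 2)
      (fun u => e / r * u - B / r / u)); trivial.
    - intros u Hu. apply continuous_div; [lra| |].
      + apply (continuous_minus (V := R_NormedModule)).
        apply Hh; lra. apply continuous_const.
      + apply (ex_derive_continuous (V := R_NormedModule)). auto_derive; trivial.
    - intros u Hu. split.
      + auto_derive; [lra|]. field; lra.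
      + apply (ex_derive_continuous (V := R_NormedModule)). auto_derive; nra.
    - intros u Hu. unfold Rdiv at 1. rewrite Rabs_mult.
      rewrite (Rabs_pos_eq (/ _)) by (left; apply Rinv_0_lt_compat; lra).
      replace (e / r + B / r / u ^ 2) with ((e + B / u ^ 2) * / r) by (field; lra).
      apply Rmult_le_compat. apply Rabs_pos.
      left; apply Rinv_0_lt_compat; lra. apply Ha; lra.
      apply Rinv_le_contravar; lra. }
  assert (0 <= e / r * c).
  { apply Rmult_le_pos; [apply Rdiv_le_0_compat|]; lra. }
  assert (0 <= B / r / r).
  { apply Rdiv_le_0_compat; [apply Rdiv_le_0_compat|]; lra. }
  replace (e / r * r) with e by (field; lra).
  replace (B / (r * c)) with (B / r / c) by (field; lra). lra. }
(* Above r only the Stieltjes kernel remains; it is at most r/u^2, of integral at most 1, and B/u^2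
   <= B/(r c) there. *)
assert (I2 : is_RInt (fun u => r * (h u - a) / (u * (r + u))) r X
  (r * RInt (fun u => h u / (u * (r + u))) r X
   - a * ((ln X - ln (r + X)) - (ln r - ln (r + r))))).
{ assert (J2 := RInt_correct (V := R_CompleteNormedModule) _ _ _
     (ex1 r X ltac:(lra) ltac:(lra))).
  assert (J3 : is_RInt (fun u => r / (u * (r + u))) r X
    ((ln X - ln (r + X)) - (ln r - ln (r + r)))).
  { apply (is_RInt_derive (V := R_CompleteNormedModule)
      (fun u => ln u - ln (r + u)));
    rewrite Rmin_left by lra; intros x Hx.
    - auto_derive; [lra|]. field; lra.
    - apply (ex_derive_continuous (V := R_NormedModule)). auto_derive. nra. }
  apply (is_RInt_scal (V := R_NormedModule) _ _ _ r) in J2.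
  apply (is_RInt_scal (V := R_NormedModule) _ _ _ a) in J3.
  assert (J := is_RInt_minus (V := R_NormedModule) _ _ _ _ _ _ J2 J3).
  apply (is_RInt_ext (V := R_NormedModule)) with (2 := J).
  rewrite Rmin_left by lra. intros u Hu.
  change (r * (h u / (u * (r + u))) - a * (r / (u * (r + u)))
   = r * (h u - a) / (u * (r + u))). field; lra. }
assert (B2 : Rabs (r * RInt (fun u => h u / (u * (r + u))) r X
   - a * ((ln X - ln (r + X)) - (ln r - ln (r + r)))) <= e + B / (r * c)).
{ rewrite <- (is_RInt_unique (V := R_CompleteNormedModule) _ _ _ _ I2).
  assert (HBrc : 0 <= B / (r * c)) by (apply Rdiv_le_0_compat; nra).
  eapply Rle_trans.
  { apply (RInt_abs_le_antideriv _ (fun u => (e + B / (r * c)) * (r / u ^ 2))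
      (fun u => - (e + B / (r * c)) * (r / u))); try lra.
    - intros u Hu. apply continuous_div; [nra| |].
      + apply (continuous_scal_r (V := R_NormedModule) r (fun u => h u - a)).
        apply (continuous_minus (V := R_NormedModule)).
        apply Hh; lra. apply continuous_const.
      + apply (ex_derive_continuous (V := R_NormedModule)). auto_derive; trivial.
    - intros u Hu. split.
      + auto_derive; [lra|]. field; lra.
      + apply (ex_derive_continuous (V := R_NormedModule)). auto_derive; nra.
    - intros u Hu.
      replace (r * (h u - a) / (u * (r + u)))
        with ((h u - a) * (r / (u * (r + u)))) by (field; lra).
      rewrite Rabs_mult.
      rewrite (Rabs_pos_eq (r / _)) by (apply Rdiv_le_0_compat; nra).
      apply Rmult_le_compat. apply Rabs_pos.
      apply Rdiv_le_0_compat; nra.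
      + eapply Rle_trans; [apply Ha; lra|]. apply Rplus_le_compat_l.
        apply Rmult_le_compat_l; trivial. apply Rinv_le_contravar; nra.
      + apply Rmult_le_compat_l; [lra|]. apply Rinv_le_contravar; nra. }
  assert (0 <= (e + B / (r * c)) * (r / X)).
  { apply Rmult_le_pos; [lra|apply Rdiv_le_0_compat; lra]. }
  replace (r / r) with 1 by (field; lra). lra. }
assert (B3 : Rabs (a * (ln (r + X) - ln X)) <= d / 2).
{ rewrite Rabs_mult.
  assert (E : ln (r + X) - ln X <= r / X).
  { replace (r + X) with (X * (1 + r / X)) by (field; lra).
    assert (0 < r / X) by (apply Rdiv_lt_0_compat; lra).
    rewrite ln_mult by lra.
    assert (Hx := exp_ineq1_le (r / X)).
    apply ln_le in Hx; [|lra]. rewrite ln_exp in Hx. lra. }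
  assert (E0 : 0 <= ln (r + X) - ln X).
  { assert (ln X <= ln (r + X)) by (apply ln_le; lra). lra. }
  rewrite (Rabs_pos_eq (ln (r + X) - ln X)) by trivial.
  apply Rle_trans with (Rabs a * (r / X)).
  { apply Rmult_le_compat_l; trivial. apply Rabs_pos. }
  apply Rmult_lt_compat_r with (r := d) in HX3; trivial.
  unfold Rdiv in HX3. rewrite Rmult_assoc, Rinv_l in HX3 by lra.
  apply Rmult_le_reg_r with (2 * X); [lra|].
  replace (Rabs a * (r / X) * (2 * X)) with (2 * r * Rabs a) by (field; lra).
  lra. }
assert (B4 : Rabs (r * Re I - r * RInt (fun u => h u / (u * (r + u))) c X) <= d / 2).
{ rewrite <- Rmult_minus_distr_l, Rabs_mult, (Rabs_pos_eq r), Rabs_minus_sym by lra.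
  apply Rmult_lt_compat_l with (r := r) in HX0; [|lra].
  replace (r * (d / (2 * r))) with (d / 2) in HX0 by (field; lra). lra. }
(* Subtracting the quantity of [B1] from that of [B2] cancels a ln (2 r) and leaves a ln ((r + c)/r)
   besides the vanishing term of [B3]. *)
rewrite <- Ech in B4. unfold Rdiv at 2.
rewrite ln_mult, ln_Rinv by (try apply Rinv_0_lt_compat; lra).
replace (2 * B / (r * c)) with (2 * (B / (r * c))) by (field; lra).
apply Rabs_le_between in B1. apply Rabs_le_between in B2.
apply Rabs_le_between in B3. apply Rabs_le_between in B4.
apply Rabs_le_between. lra.
Qed.

(** * Complex primitives of kernels in the integration variable *)

Lemma is_Cderive_Cinv (z : C) : z <> RtoC 0 -> is_Cderive Cinv z (- / (z * z))%C.
Proof.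
intros Hz. assert (H0 := proj1 (Cmod_gt_0 z) Hz).
apply (is_Cderive_intro _ _ _ (Cmod z / 2) (2 / Cmod z ^ 3)); [lra|].
intros s Hs.
assert (Hs1 : Cmod z / 2 <= Cmod s).
{ assert (H := Cmod_triangle s (- (s - z))%C). rewrite Cmod_opp in H.
  replace (s + - (s - z))%C with z in H by ring. lra. }
assert (Hs0 : s <> RtoC 0) by (apply Cmod_gt_0; lra).
replace (/ s - / z - (s - z) * - / (z * z))%C
  with ((s - z) * (s - z) / (s * (z * z)))%C by (field; split; trivial).
rewrite Cmod_div, !Cmod_mult by (repeat apply Cmult_neq_0; trivial).
replace (2 / Cmod z ^ 3 * Cmod (s - z) ^ 2)
  with (Cmod (s - z) * Cmod (s - z) * (/ (Cmod z / 2 * (Cmod z * Cmod z))))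
  by (field; lra).
apply Rmult_le_compat_l.
- apply Rmult_le_pos; apply Cmod_ge_0.
- apply Rinv_le_contravar.
  + apply Rmult_lt_0_compat; nra.
  + apply Rmult_le_compat_r; nra.
Qed.

Lemma is_Cderive_shift_inv (s z : C) : (s + z)%C <> RtoC 0 ->
  is_Cderive (fun w => / (s + w))%C z (- / ((s + z) * (s + z)))%C.
Proof.
intros H.
replace (- / ((s + z) * (s + z)))%C with (1 * - / ((s + z) * (s + z)))%C by ring.
apply (is_Cderive_comp Cinv (fun w => s + w)%C).
- apply is_Cderive_Cinv; trivial.
- apply (is_Cderive_intro _ _ _ 1 0); [lra|]. intros w _.
  replace (s + w - (s + z) - (w - z) * 1)%C with (RtoC 0) by ring.
  rewrite Cmod_0. lra.
Qed.

Lemma is_Cint_antideriv c (F : C -> C) (f : R -> C) :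
  (forall u, c <= u -> is_Cderive F (RtoC u) (f u)) ->
  (forall u, c <= u -> continuous f u) ->
  (forall e, 0 < e -> exists X0, forall X, X0 < X -> Cmod (F (RtoC X)) < e) ->
  is_Cint c f (- F (RtoC c))%C.
Proof.
intros HF Hf Hlim. apply is_Cint_iff. intros eps.
destruct (Hlim eps (cond_pos eps)) as [X0 H].
exists (Rmax X0 c). intros X HX.
assert (H1 := Rmax_l X0 c). assert (H2 := Rmax_r X0 c).
exists (F (RtoC X) - F (RtoC c))%C. split.
- apply (is_RInt_derive (V := C_R_CompleteNormedModule) (fun u => F (RtoC u)) f);
  rewrite Rmin_left, Rmax_right by lra; intros u Hu.
  + apply is_Cderive_real_axis, HF; lra.
  + apply Hf; lra.
- apply ball_Cmod.
  replace (F (RtoC X) - F (RtoC c) - - F (RtoC c))%C with (F (RtoC X)) by ring.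
  apply H; lra.
Qed.

(** * Integrals against powers of the Cauchy kernel *)

(* [s] stays away from the cut, quantitatively. *)
Definition away (c : R) (s : C) (d : R) : Prop :=
  0 < d /\ forall u, c <= u -> d * u <= Cmod (s + RtoC u)%C.

Lemma away_neq_0 c s d u : 0 < c -> away c s d -> c <= u ->
  (s + RtoC u)%C <> RtoC 0.
Proof.
intros Hc [Hd H] Hu. apply Cmod_gt_0. specialize (H u Hu). nra.
Qed.

(** Openness of the region, with the explicit radius d c/2 that serves as the neighbourhood in all
    derivatives of integrals: moving [s] costs at most d u/2 because u >= c. *)
Lemma away_near c s d z : 0 < c -> away c z d -> Cmod (s - z)%C < d * c / 2 ->
  away c s (d / 2).
Proof.
intros Hc [Hd H] Hs. split; [lra|]. intros u Hu. specialize (H u Hu).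
assert (H1 := Cmod_triangle (s + RtoC u)%C (- (s - z))%C).
rewrite Cmod_opp in H1.
replace (s + RtoC u + - (s - z))%C with (z + RtoC u)%C in H1 by ring.
nra.
Qed.

(** From u <= |s + u| + |s| and m <= |s + u| follows m u <= (m + |s|) |s + u|. *)
Lemma away_of_lower_bound c m s : 0 < c -> 0 < m ->
  (forall u, c <= u -> m <= Cmod (s + RtoC u)%C) -> exists d, away c s d.
Proof.
intros Hc Hm0 Hm.
assert (Hs := Cmod_ge_0 s).
exists (m / (m + Cmod s)). split; [apply Rdiv_lt_0_compat; lra|].
intros u Hu. specialize (Hm u Hu).
assert (Ht := Cmod_triangle (s + RtoC u)%C (- s)%C). rewrite Cmod_opp in Ht.
replace (s + RtoC u + - s)%C with (RtoC u) in Ht by ring.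
rewrite Cmod_R, Rabs_pos_eq in Ht by lra.
apply Rmult_le_reg_l with (m + Cmod s); [lra|].
replace ((m + Cmod s) * (m / (m + Cmod s) * u)) with (m * u) by (field; lra).
nra.
Qed.

(** Off the real axis |Im s| bounds |s + u| from below; for real s > -c the bound is s + c. The cut
    is excluded in two ways: s = -c as the vertex, s < -c because the argument of s + c is PI. *)
Lemma angle_away c s : 0 < c -> angle c PI s -> exists d, away c s d.
Proof.
intros Hc [H1 H2].
assert (Hm : exists m, 0 < m /\ forall u, c <= u -> m <= Cmod (s + RtoC u)%C).
{ destruct s as [x y].
  assert (Hx : forall u, Rabs (x + u) <= Cmod ((x, y) + RtoC u)%C).
  { intros u. apply (re_le_Cmod ((x, y) + RtoC u)%C). }
  assert (Hy : forall u, Rabs y <= Cmod ((x, y) + RtoC u)%C).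
  { intros u. eapply Rle_trans; [|apply Rmax_Cmod].
    eapply Rle_trans; [|apply Rmax_r]. simpl. rewrite Rplus_0_r. apply Rle_refl. }
  destruct (Req_dec y 0) as [Hy0|Hy0].
  - destruct (Rlt_le_dec (- c) x) as [Hxc|Hxc].
    + exists (x + c). split; [lra|]. intros u Hu.
      eapply Rle_trans; [|apply Hx]. rewrite Rabs_pos_eq; lra.
    + exfalso. subst y.
      assert (Hneg : x + c < 0).
      { destruct (Req_dec (x + c) 0) as [E|E]; [|lra].
        exfalso; apply H1. unfold Cplus, RtoC; simpl. rewrite E. f_equal; ring. }
      assert (E : ((x, 0) + RtoC c)%C = RtoC (x + c)).
      { unfold Cplus, RtoC; simpl. f_equal; ring. }
      rewrite E in H2. unfold Carg in H2. rewrite im_RtoC, re_RtoC, Cmod_R in H2.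
      destruct (Rle_dec 0 0) as [_|]; [|lra].
      rewrite (Rabs_left (x + c)) in H2 by lra.
      replace ((x + c) / - (x + c)) with (- (1)) in H2 by (field; lra).
      rewrite acos_opp, acos_1 in H2.
      replace (PI - 0) with PI in H2 by ring.
      assert (HPI := PI_RGT_0). rewrite Rabs_pos_eq in H2; lra.
  - exists (Rabs y). split; [apply Rabs_pos_lt; trivial|]. intros u _. apply Hy. }
destruct Hm as [m [Hm0 Hm]]. apply (away_of_lower_bound c m s); trivial.
Qed.

Lemma away_real c (x : R) : 0 < c -> - c < x -> exists d, away c (RtoC x) d.
Proof.
intros Hc Hx. apply (away_of_lower_bound c (x + c)); try lra.
intros u Hu. rewrite <- RtoC_plus, Cmod_R, Rabs_pos_eq; lra.
Qed.

Lemma away_pos c (r : R) : 0 < c -> 0 < r -> away c (RtoC r) 1.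
Proof.
intros Hc Hr. split; [lra|]. intros u Hu.
rewrite <- RtoC_plus, Cmod_R, Rabs_pos_eq; lra.
Qed.

(** With k = cos delta and cos theta >= -k, the squared modulus is at least r^2 + u^2 - 2 k r u = (1
    - k)/2 (r + u)^2 + (1 + k)/2 (r - u)^2. This would give the constant sin (delta/2), the square
    root of (1 - k)/2; the smaller (1 - k)/2 avoids the root. *)
Lemma Cmod_sector_shift_ge delta r theta u :
  0 < delta <= PI -> Rabs theta <= PI - delta -> 0 < r -> 0 <= u ->
  (1 - cos delta) / 2 * (r + u)
    <= Cmod (RtoC r * Cexp (Ci * RtoC theta) + RtoC u)%C.
Proof.
intros Hd Ht Hr Hu.
assert (HPI := PI_RGT_0).
assert (Hct : - cos delta <= cos theta).
{ replace (cos theta) with (cos (Rabs theta)).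
  - replace (- cos delta) with (cos (PI - delta)).
    + apply cos_decr_1; generalize (Rabs_pos theta); lra.
    + unfold Rminus. rewrite Rplus_comm, neg_cos, cos_neg; trivial.
  - unfold Rabs; destruct Rcase_abs; trivial. apply cos_neg. }
assert (Hcd := COS_bound delta).
set (k := cos delta) in *.
unfold Cmod.
rewrite <- (sqrt_Rsqr ((1 - k) / 2 * (r + u))) by (apply Rmult_le_pos; lra).
apply sqrt_le_1_alt. unfold Rsqr, Cexp, Re, Im; simpl.
replace (0 * theta - 1 * 0) with 0 by ring.
replace (0 * 0 + 1 * theta) with theta by ring.
rewrite exp_0.
assert (Hsc := sin2_cos2 theta). unfold Rsqr in Hsc.
set (C := cos theta) in *. set (S := sin theta) in *.
match goal with |- _ <= ?t =>
  replace t with (r * r * (S * S + C * C) + u * u + 2 * r * u * C) by ring end.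
rewrite Hsc.
assert (0 <= r * u) by (apply Rmult_le_pos; lra).
apply Rle_trans with ((1 - k) / 2 * ((r + u) * (r + u))).
- assert (0 <= (r + u) * (r + u)) by nra.
  replace ((1 - k) / 2 * (r + u) * ((1 - k) / 2 * (r + u)))
    with ((1 - k) / 2 * ((1 - k) / 2 * ((r + u) * (r + u)))) by ring.
  apply Rmult_le_compat_l; [lra|]. nra.
- assert (0 <= (1 + k) / 2 * ((r - u) * (r - u)))
    by (apply Rmult_le_pos; [lra|apply Rle_0_sqr]).
  assert (0 <= r * u * (C + k)) by (apply Rmult_le_pos; lra).
  lra.
Qed.

(** * Stieltjes transforms of h and their derivatives *)

Lemma is_Cint_RInt_gen c f : (exists I, is_Cint c f I) ->
  is_Cint c f (RInt_gen (V := C_R_CompleteNormedModule) f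
                 (at_point c) (Rbar_locally p_infty)).
Proof. intros [I HI]. rewrite (RInt_gen_Cint _ _ _ HI). exact HI. Qed.

(** For h(u) = u l'(u)/l(u) this is the integral in [gamma]. [RInt_gen] is total, so this value and
    those of the next two definitions carry meaning only where convergence is established, that is
    at points with [away c s d]. *)
Definition Stieltjes1 (h : R -> R) (c : R) (s : C) : C :=
  RInt_gen (V := C_R_CompleteNormedModule)
    (fun u => RtoC (h u / u) / (s + RtoC u))%C
    (at_point c) (Rbar_locally p_infty).

Definition Stieltjes2 (h : R -> R) (c : R) (s : C) : C :=
  RInt_gen (V := C_R_CompleteNormedModule)
    (fun u => RtoC (h u) / ((s + RtoC u) * (s + RtoC u)))%C
    (at_point c) (Rbar_locally p_infty).

Definition Stieltjes3 (h : R -> R) (c : R) (s : C) : C :=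
  RInt_gen (V := C_R_CompleteNormedModule)
    (fun u => RtoC (h u) / ((s + RtoC u) * (s + RtoC u) * (s + RtoC u)))%C
    (at_point c) (Rbar_locally p_infty).

Lemma is_Cint_Stieltjes1 h c M s d : 0 < c -> away c s d ->
  (forall u, c <= u -> continuous h u /\ 0 <= h u <= M) ->
  is_Cint c (fun u => RtoC (h u / u) / (s + RtoC u))%C (Stieltjes1 h c s).
Proof.
intros Hc Hs Hh. apply is_Cint_RInt_gen.
assert (HM : 0 <= M) by (destruct (Hh c); lra).
assert (Hd := proj1 Hs).
apply (ex_Cint _ _ _ _ _ (fun u Hu => continuous_Cdiv _ _ u
   (away_neq_0 _ _ _ _ Hc Hs Hu)
   (continuous_RtoC _ _ (continuous_div _ _ _ (Rgt_not_eq _ _ (Rlt_le_trans _ _ _ Hc Hu))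
      (proj1 (Hh u Hu)) (continuous_id u))) (continuous_shift s u))
   (dominator_inv_sqr c (M / d) Hc (Rdiv_le_0_compat _ _ HM Hd))).
intros u Hu.
rewrite Cmod_div, Cmod_R by (apply (away_neq_0 c s d); trivial).
destruct (Hh u Hu) as [_ Hhu].
rewrite Rabs_pos_eq by (apply Rdiv_le_0_compat; lra).
replace (M / d / u ^ 2) with (M / u * / (d * u)) by (field; lra).
apply Rmult_le_compat.
- apply Rdiv_le_0_compat; lra.
- left; apply Rinv_0_lt_compat, Cmod_gt_0, (away_neq_0 c s d); trivial.
- apply Rmult_le_compat_r; [left; apply Rinv_0_lt_compat; lra|lra].
- apply Rinv_le_contravar; [nra|apply Hs; trivial].
Qed.

Lemma is_Cint_Stieltjes2 h c M s d : 0 < c -> away c s d ->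
  (forall u, c <= u -> continuous h u /\ 0 <= h u <= M) ->
  is_Cint c (fun u => RtoC (h u) / ((s + RtoC u) * (s + RtoC u)))%C
    (Stieltjes2 h c s).
Proof.
intros Hc Hs Hh. apply is_Cint_RInt_gen.
assert (HM : 0 <= M) by (destruct (Hh c); lra).
assert (Hd := proj1 Hs).
assert (Hn : forall u, c <= u -> ((s + RtoC u) * (s + RtoC u))%C <> RtoC 0).
{ intros u Hu. apply Cmult_neq_0; apply (away_neq_0 c s d); trivial. }
assert (HMd : 0 <= M / d ^ 2).
{ apply Rdiv_le_0_compat; trivial. apply pow_lt; trivial. }
refine (ex_Cint _ _ _ _ _ _ (dominator_inv_sqr c _ Hc HMd) _).
- intros u Hu. apply continuous_Cdiv; auto.
  + apply continuous_RtoC, Hh; trivial.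
  + apply continuous_Cmult; apply continuous_shift.
- intros u Hu. rewrite Cmod_div, Cmod_R, Cmod_mult by auto.
  destruct (Hh u Hu) as [_ Hhu]. rewrite Rabs_pos_eq by lra.
  replace (M / d ^ 2 / u ^ 2) with (M * / ((d * u) * (d * u))) by (field; lra).
  assert (Hl := proj2 Hs u Hu).
  assert (0 < d * u) by nra.
  apply Rmult_le_compat; try lra.
  + left; apply Rinv_0_lt_compat; nra.
  + apply Rinv_le_contravar; nra.
Qed.

Lemma is_Cint_Stieltjes3 h c M s d : 0 < c -> away c s d ->
  (forall u, c <= u -> continuous h u /\ 0 <= h u <= M) ->
  is_Cint c
    (fun u => RtoC (h u) / ((s + RtoC u) * (s + RtoC u) * (s + RtoC u)))%C
    (Stieltjes3 h c s).
Proof.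
intros Hc Hs Hh. apply is_Cint_RInt_gen.
assert (HM : 0 <= M) by (destruct (Hh c); lra).
assert (Hd := proj1 Hs).
assert (Hn : forall u, c <= u ->
  ((s + RtoC u) * (s + RtoC u) * (s + RtoC u))%C <> RtoC 0).
{ intros u Hu. repeat apply Cmult_neq_0; apply (away_neq_0 c s d); trivial. }
(* Two of the three factors supply 1/u^2; the third is only bounded below by d c, so that the same
   majorant A/u^2 serves again. *)
assert (HMd : 0 <= M / (d ^ 3 * c)).
{ apply Rdiv_le_0_compat; trivial. apply Rmult_lt_0_compat; trivial.
  apply pow_lt; trivial. }
refine (ex_Cint _ _ _ _ _ _ (dominator_inv_sqr c _ Hc HMd) _).
- intros u Hu. apply continuous_Cdiv; auto.
  + apply continuous_RtoC, Hh; trivial.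
  + apply continuous_Cmult; [apply continuous_Cmult|]; apply continuous_shift.
- intros u Hu. rewrite Cmod_div, Cmod_R, !Cmod_mult by auto.
  destruct (Hh u Hu) as [_ Hhu]. rewrite Rabs_pos_eq by lra.
  replace (M / (d ^ 3 * c) / u ^ 2) with (M * / ((d * u) * (d * u) * (d * c)))
    by (field; lra).
  assert (Hl := proj2 Hs u Hu).
  assert (0 < d * c) by nra. assert (d * c <= d * u) by nra.
  assert (Hm : d * u * (d * u) * (d * c) <=
    Cmod (s + RtoC u) * Cmod (s + RtoC u) * Cmod (s + RtoC u)).
  { apply Rmult_le_compat; try nra. }
  assert (0 < d * u * (d * u) * (d * c)) by (apply Rmult_lt_0_compat; nra).
  apply Rmult_le_compat; try lra.
  + left; apply Rinv_0_lt_compat; lra.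
  + apply Rinv_le_contravar; lra.
Qed.

(** The factor s is what makes this clean: s/(s + u) has derivative u/(s + u)^2, whose u cancels the
    one in h(u)/u. Away from 0, s times the transform is log L(s). *)
Lemma is_Cderive_Stieltjes1 h c M z d : 0 < c -> away c z d ->
  (forall u, c <= u -> continuous h u /\ 0 <= h u <= M) ->
  is_Cderive (fun s => s * Stieltjes1 h c s)%C z (Stieltjes2 h c z).
Proof.
intros Hc Hz Hh.
assert (HM : 0 <= M) by (destruct (Hh c); lra).
assert (Hd := proj1 Hz).
assert (Heta : 0 < d * c / 2) by nra.
assert (HA : 0 <= M * (2 / (d ^ 3 * c))).
{ apply Rmult_le_pos; trivial. apply Rdiv_le_0_compat; [lra|].
  apply Rmult_lt_0_compat; trivial. apply pow_lt; trivial. }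
apply (is_Cderive_Cint c (fun s u => s * (RtoC (h u / u) / (s + RtoC u)))%C
  _ _ z _ _ _ Hc Heta HA) with (2 := is_Cint_Stieltjes2 h c M z d Hc Hz Hh).
- intros s Hs. apply is_Cint_mult.
  apply (is_Cint_Stieltjes1 h c M s (d / 2)); trivial.
  apply (away_near c s d z); trivial.
- intros s u Hs Hu.
  assert (Hs' := away_near c s d z Hc Hz Hs).
  assert (N1 := away_neq_0 c s (d / 2) u Hc Hs' Hu).
  assert (N2 := away_neq_0 c z d u Hc Hz Hu).
  assert (Hl1 := proj2 Hs' u Hu). assert (Hl2 := proj2 Hz u Hu).
  assert (Nu : RtoC u <> RtoC 0) by (intros E; apply RtoC_inj in E; lra).
  destruct (Hh u Hu) as [_ Hhu].
  match goal with |- Cmod ?t <= _ => replace t with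
    (RtoC (- h u) * ((s - z) * (s - z)
      / ((s + RtoC u) * ((z + RtoC u) * (z + RtoC u)))))%C end.
  2:{ rewrite RtoC_div, RtoC_opp by lra. field. repeat split; trivial. }
  rewrite Cmod_mult, Cmod_div, !Cmod_mult, Cmod_R, Rabs_Ropp, Rabs_pos_eq
    by (try lra; repeat apply Cmult_neq_0; trivial).
  replace (M * (2 / (d ^ 3 * c)) * Cmod (s - z) ^ 2 / u ^ 2)
    with (M * (Cmod (s - z) * Cmod (s - z) * / (d / 2 * c * (d * u * (d * u)))))
    by (field; lra).
  assert (P1 : 0 < d * u) by nra. assert (P2 : d / 2 * c <= d / 2 * u) by nra.
  assert (P3 : 0 < d / 2 * c) by nra.
  assert (P4 : 0 < d / 2 * c * (d * u * (d * u))) by (apply Rmult_lt_0_compat; nra).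
  assert (P5 : d / 2 * c * (d * u * (d * u)) <=
     Cmod (s + RtoC u) * (Cmod (z + RtoC u) * Cmod (z + RtoC u))).
  { apply Rmult_le_compat; nra. }
  assert (P6 : 0 <= Cmod (s - z) * Cmod (s - z))
    by (apply Rmult_le_pos; apply Cmod_ge_0).
  apply Rmult_le_compat; try lra.
  + apply Rdiv_le_0_compat; lra.
  + apply Rmult_le_compat_l; trivial. apply Rinv_le_contravar; lra.
Qed.

Lemma is_Cderive_Stieltjes2 h c M z d : 0 < c -> away c z d ->
  (forall u, c <= u -> continuous h u /\ 0 <= h u <= M) ->
  is_Cderive (Stieltjes2 h c) z (RtoC (-2) * Stieltjes3 h c z)%C.
Proof.
intros Hc Hz Hh.
assert (HM : 0 <= M) by (destruct (Hh c); lra).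
assert (Hd := proj1 Hz).
assert (Heta : 0 < d * c / 2) by nra.
assert (HA : 0 <= M * (8 / (d ^ 4 * c ^ 2))).
{ apply Rmult_le_pos; trivial. apply Rdiv_le_0_compat; [lra|].
  apply Rmult_lt_0_compat; apply pow_lt; trivial. }
apply (is_Cderive_Cint c
  (fun s u => RtoC (h u) / ((s + RtoC u) * (s + RtoC u)))%C
  _ _ z _ _ _ Hc Heta HA)
  with (2 := is_Cint_mult _ _ _ _ (is_Cint_Stieltjes3 h c M z d Hc Hz Hh)).
- intros s Hs.
  apply (is_Cint_Stieltjes2 h c M s (d / 2)); trivial.
  apply (away_near c s d z); trivial.
- intros s u Hs Hu.
  assert (Hs' := away_near c s d z Hc Hz Hs).
  assert (N1 := away_neq_0 c s (d / 2) u Hc Hs' Hu).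
  assert (N2 := away_neq_0 c z d u Hc Hz Hu).
  assert (Hl1 := proj2 Hs' u Hu). assert (Hl2 := proj2 Hz u Hu).
  destruct (Hh u Hu) as [_ Hhu].
  (* With [a = z + u], [b = s + u] and [w = s - z],
     [1/b^2 - 1/a^2 + 2w/a^3 = w^2 (1/(b^2 a^2) + 2/(b a^3))]. *)
  set (b := (s + RtoC u)%C) in *. set (a := (z + RtoC u)%C) in *.
  match goal with |- Cmod ?t <= _ => replace t with
    (RtoC (h u) * ((s - z) * (s - z)
      * (/ (b * b * (a * a)) + (RtoC 2) * / (b * (a * a * a)))))%C end.
  2:{ replace (s - z)%C with (b - a)%C by (unfold a, b; ring).
      replace (RtoC (-2)) with (- RtoC 2)%C by (rewrite <- RtoC_opp; reflexivity).
      field. split; trivial. }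
  rewrite !Cmod_mult, Cmod_R, (Rabs_pos_eq (h u)) by lra.
  replace (M * (8 / (d ^ 4 * c ^ 2)) * Cmod (s - z) ^ 2 / u ^ 2)
    with (M * (Cmod (s - z) * Cmod (s - z) * (8 / (d ^ 4 * c ^ 2 * u ^ 2))))
    by (field; lra).
  assert (P6 : 0 <= Cmod (s - z) * Cmod (s - z))
    by (apply Rmult_le_pos; apply Cmod_ge_0).
  apply Rmult_le_compat; try lra.
  { apply Rmult_le_pos; trivial; apply Cmod_ge_0. }
  apply Rmult_le_compat_l; trivial.
  eapply Rle_trans; [apply Cmod_triangle|].
  rewrite Cmod_mult, !Cmod_inv, !Cmod_mult, Cmod_R, Rabs_pos_eq
    by (try lra; repeat apply Cmult_neq_0; trivial).
  assert (P1 : 0 < d * u) by nra. assert (P2 : d * c <= d * u) by nra.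
  assert (P3 : 0 < d * c) by nra.
  assert (Q1 : d * c / 2 * (d * c / 2) <= Cmod b * Cmod b)
    by (apply Rmult_le_compat; lra).
  assert (Q2 : d * u * (d * u) <= Cmod a * Cmod a)
    by (apply Rmult_le_compat; lra).
  assert (Q3 : d * u * (d * u) * (d * c) <= Cmod a * Cmod a * Cmod a)
    by (apply Rmult_le_compat; nra).
  assert (R1 : / (Cmod b * Cmod b * (Cmod a * Cmod a))
     <= / (d * c / 2 * (d * c / 2) * (d * u * (d * u)))).
  { apply Rinv_le_contravar.
    - apply Rmult_lt_0_compat; nra.
    - apply Rmult_le_compat; nra. }
  assert (R2 : / (Cmod b * (Cmod a * Cmod a * Cmod a))
     <= / (d * c / 2 * (d * u * (d * u) * (d * c)))).
  { assert (0 < d * u * (d * u) * (d * c)) by (apply Rmult_lt_0_compat; nra).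
    apply Rinv_le_contravar.
    - apply Rmult_lt_0_compat; nra.
    - apply Rmult_le_compat; nra. }
  (* The 8 in the remainder constant is 4 + 4, one 4 from each of the two terms. *)
  replace (8 / (d ^ 4 * c ^ 2 * u ^ 2))
    with (/ (d * c / 2 * (d * c / 2) * (d * u * (d * u)))
     + 2 * / (d * c / 2 * (d * u * (d * u) * (d * c)))) by (field; lra).
  lra.
Qed.

Lemma is_Cderive_const (k z : C) : is_Cderive (fun _ => k) z (RtoC 0).
Proof.
apply (is_Cderive_intro _ _ _ 1 0); [lra|]. intros w _.
replace (k - k - (w - z) * 0)%C with (RtoC 0) by ring.
rewrite Cmod_0. lra.
Qed.

Lemma is_Cint_inv_sqr c s d : 0 < c -> away c s d ->
  is_Cint c (fun u => / ((s + RtoC u) * (s + RtoC u)))%C (/ (s + RtoC c))%C.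
Proof.
intros Hc Hs.
replace (/ (s + RtoC c))%C with (- (- RtoC 1 * / (s + RtoC c)))%C by ring.
apply (is_Cint_antideriv c (fun w => - RtoC 1 * / (s + w))%C).
- intros u Hu. assert (N := away_neq_0 c s d u Hc Hs Hu).
  replace (/ ((s + RtoC u) * (s + RtoC u)))%C with
    (RtoC 0 * / (s + RtoC u)
      + - RtoC 1 * (- / ((s + RtoC u) * (s + RtoC u))))%C by ring.
  apply (is_Cderive_mult (fun _ => - RtoC 1)%C (fun w => / (s + w))%C).
  + apply is_Cderive_const.
  + apply is_Cderive_shift_inv; trivial.
- intros u Hu. assert (N := away_neq_0 c s d u Hc Hs Hu).
  apply (continuous_Cinv (fun u => (s + RtoC u) * (s + RtoC u))%C).
  + apply Cmult_neq_0; trivial.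
  + apply continuous_Cmult; apply continuous_shift.
- intros e He. assert (Hd := proj1 Hs).
  exists (Rmax c (/ (d * e))). intros X HX.
  assert (H1 := Rmax_l c (/ (d * e))). assert (H2 := Rmax_r c (/ (d * e))).
  assert (Hl := proj2 Hs X ltac:(lra)).
  assert (N := away_neq_0 c s d X Hc Hs ltac:(lra)).
  rewrite Cmod_mult, Cmod_opp, Cmod_1, Rmult_1_l, Cmod_inv by trivial.
  assert (0 < d * e) by nra. assert (0 < d * X) by nra.
  apply Rle_lt_trans with (/ (d * X)).
  + apply Rinv_le_contravar; lra.
  + rewrite <- (Rinv_inv e). apply Rinv_lt_contravar.
    * apply Rmult_lt_0_compat; trivial. apply Rinv_0_lt_compat; trivial.
    * apply Rmult_lt_reg_r with (/ d); [apply Rinv_0_lt_compat; trivial|].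
      assert (H3 : / (d * e) < X) by lra. rewrite Rinv_mult in H3.
      replace (d * X * / d) with X by (field; lra). lra.
Qed.

(** (u - r)/(r + u)^3 = 1/(r + u)^2 - 2 r/(r + u)^3 is the kernel of eps'(r), with primitive -u/(r +
    u)^2. The parts below and above u = r nearly cancel, so the constant part of h contributes only
    O(1/r^2) to eps'(r). *)
Lemma is_Cint_inv_sqr_sub_inv_cube c (r : R) : 0 < c -> 0 < r ->
  is_Cint c (fun u => RtoC ((u - r) / (r + u) ^ 3)) (RtoC (c / (r + c) ^ 2)).
Proof.
intros Hc Hr.
assert (N : forall u, c <= u -> (RtoC r + RtoC u)%C <> RtoC 0).
{ intros u Hu. rewrite <- RtoC_plus. intros E; apply RtoC_inj in E; lra. }
assert (E0 : forall u, c <= u ->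
  (- RtoC u * (/ (RtoC r + RtoC u) * / (RtoC r + RtoC u)))%C
   = RtoC (- (u / (r + u) ^ 2))).
{ intros u Hu. rewrite <- RtoC_plus, <- RtoC_inv, <- RtoC_opp, <- !RtoC_mult by lra.
  f_equal. field. lra. }
replace (RtoC (c / (r + c) ^ 2)) with
  (- (- RtoC c * (/ (RtoC r + RtoC c) * / (RtoC r + RtoC c))))%C
  by (rewrite E0, <- RtoC_opp by lra; f_equal; ring).
apply (is_Cint_antideriv c (fun w => - w * (/ (RtoC r + w) * / (RtoC r + w)))%C).
- intros u Hu. specialize (N u Hu).
  replace (RtoC ((u - r) / (r + u) ^ 3)) with
   (- RtoC 1 * (/ (RtoC r + RtoC u) * / (RtoC r + RtoC u))
    + - RtoC u * (- / ((RtoC r + RtoC u) * (RtoC r + RtoC u)) * / (RtoC r + RtoC u)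
     + / (RtoC r + RtoC u) * - / ((RtoC r + RtoC u) * (RtoC r + RtoC u))))%C.
  + apply (is_Cderive_mult (fun w => - w)%C
      (fun w => / (RtoC r + w) * / (RtoC r + w))%C).
    * apply (is_Cderive_intro _ _ _ 1 0); [lra|]. intros w _.
      replace (- w - - RtoC u - (w - RtoC u) * - RtoC 1)%C with (RtoC 0) by ring.
      rewrite Cmod_0. lra.
    * apply (is_Cderive_mult (fun w => / (RtoC r + w))%C (fun w => / (RtoC r + w))%C);
      apply is_Cderive_shift_inv; trivial.
  + rewrite <- RtoC_plus, <- RtoC_mult, <- !RtoC_inv, <- !RtoC_opp, <- !RtoC_mult,
      <- !RtoC_plus, <- RtoC_mult, <- RtoC_plus by nra.
    f_equal. field. lra.
- intros u Hu. apply continuous_RtoC.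
  apply (ex_derive_continuous (V := R_NormedModule)). auto_derive.
  assert (0 < (r + u) ^ 3) by (apply pow_lt; lra). simpl in *; lra.
- intros e He. exists (Rmax c (/ e)). intros X HX.
  assert (H1 := Rmax_l c (/ e)). assert (H2 := Rmax_r c (/ e)).
  rewrite E0, Cmod_R, Rabs_Ropp by lra.
  rewrite Rabs_pos_eq by (apply Rdiv_le_0_compat; [lra|apply pow_lt; lra]).
  assert (0 < / e) by (apply Rinv_0_lt_compat; trivial).
  apply Rle_lt_trans with (/ X).
  + apply Rmult_le_reg_r with (X * (r + X) ^ 2).
    { apply Rmult_lt_0_compat; [lra|apply pow_lt; lra]. }
    replace (X / (r + X) ^ 2 * (X * (r + X) ^ 2)) with (X * X) by (field; lra).
    replace (/ X * (X * (r + X) ^ 2)) with ((r + X) * (r + X)) by (field; lra).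
    nra.
  + rewrite <- (Rinv_inv e). apply Rinv_lt_contravar; [|lra].
    apply Rmult_lt_0_compat; lra.
Qed.

(** * The logarithm of gamma and the asymptotics of eps *)

(** The exponent of [gamma] itself. Being analytic off the cut and real on (-c, +oo), it is the
    required branch of the logarithm, with no argument to be followed. *)
Definition log_gamma (h : R -> R) (c : R) (s : C) : C :=
  (s * s * Stieltjes1 h c s)%C.

Lemma is_Cderive_log_gamma h c M z d : 0 < c -> away c z d ->
  (forall u, c <= u -> continuous h u /\ 0 <= h u <= M) ->
  is_Cderive (log_gamma h c) z
    (1 * (z * Stieltjes1 h c z) + z * Stieltjes2 h c z)%C.
Proof.
intros Hc Hz Hh.
apply (is_Cderive_ext_loc (fun s => s * (s * Stieltjes1 h c s))%C _ _ _ 1); [lra| |].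
- intros s _. unfold log_gamma. ring.
- apply (is_Cderive_mult (fun s => s) (fun s => s * Stieltjes1 h c s)%C).
  + apply is_Cderive_id.
  + apply (is_Cderive_Stieltjes1 h c M z d); trivial.
Qed.

Lemma near_neq_0 (s z : C) : Cmod (s - z)%C < Cmod z -> s <> RtoC 0.
Proof.
intros H E. subst s. replace (RtoC 0 - z)%C with (- z)%C in H by ring.
rewrite Cmod_opp in H. lra.
Qed.

(** L is exp of s times [Stieltjes1], so its logarithmic derivative is [Stieltjes2]. The division by
    s in [Lfun] is cancelled only for s <> 0, whence a neighbourhood of radius |z|. *)
Lemma eps_log_gamma h c M z d : 0 < c -> away c z d -> z <> RtoC 0 ->
  (forall u, c <= u -> continuous h u /\ 0 <= h u <= M) ->
  eps (log_gamma h c) z = (z * Stieltjes2 h c z)%C.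
Proof.
intros Hc Hz Hz0 Hh.
assert (E : forall s, s <> RtoC 0 ->
  Cexp (s * Stieltjes1 h c s) = Lfun (log_gamma h c) s).
{ intros s Hs. unfold Lfun, log_gamma. f_equal. field. trivial. }
unfold eps.
rewrite (is_Cderive_C_derive (Lfun (log_gamma h c)) z
  (Stieltjes2 h c z * Cexp (z * Stieltjes1 h c z))%C).
- rewrite <- E by trivial. field. apply Cexp_neq_0.
- apply (is_Cderive_ext_loc (fun s => Cexp (s * Stieltjes1 h c s)) _ _ _ (Cmod z)).
  + apply Cmod_gt_0; trivial.
  + intros s Hs. apply E, (near_neq_0 s z), Hs.
  + apply (is_Cderive_comp Cexp (fun s => s * Stieltjes1 h c s)%C).
    * apply is_Cderive_Cexp.
    * apply (is_Cderive_Stieltjes1 h c M z d); trivial.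
Qed.

Lemma is_Cderive_eps h c M z d : 0 < c -> away c z d -> z <> RtoC 0 ->
  (forall u, c <= u -> continuous h u /\ 0 <= h u <= M) ->
  is_Cderive (eps (log_gamma h c)) z
    (1 * Stieltjes2 h c z + z * (RtoC (-2) * Stieltjes3 h c z))%C.
Proof.
intros Hc Hz Hz0 Hh.
assert (Hd := proj1 Hz). assert (0 < d * c / 2) by nra.
apply (is_Cderive_ext_loc (fun s => s * Stieltjes2 h c s)%C _ _ _
  (Rmin (d * c / 2) (Cmod z))).
- apply Rmin_glb_lt; trivial. apply Cmod_gt_0; trivial.
- intros s Hs. symmetry. apply (eps_log_gamma h c M s (d / 2)); trivial.
  + apply (away_near c s d z); trivial.
    eapply Rlt_le_trans; [exact Hs|apply Rmin_l].
  + apply (near_neq_0 s z). eapply Rlt_le_trans; [exact Hs|apply Rmin_r].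
- apply (is_Cderive_mult (fun s => s) (Stieltjes2 h c)).
  + apply is_Cderive_id.
  + apply (is_Cderive_Stieltjes2 h c M z d); trivial.
Qed.

Lemma Stieltjes1_real h c M (x d : R) : 0 < c -> - c < x -> away c (RtoC x) d ->
  (forall u, c <= u -> continuous h u /\ 0 <= h u <= M) ->
  Im (Stieltjes1 h c (RtoC x)) = 0.
Proof.
intros Hc Hx Hd Hh.
apply (is_Cint_Im_0 c _ _) with (2 := is_Cint_Stieltjes1 h c M _ d Hc Hd Hh).
intros u Hu. rewrite <- RtoC_plus, <- RtoC_div by lra. apply im_RtoC.
Qed.

Lemma log_gamma_real h c M (x d : R) : 0 < c -> - c < x -> away c (RtoC x) d ->
  (forall u, c <= u -> continuous h u /\ 0 <= h u <= M) ->
  log_gamma h c (RtoC x) = RtoC (x * (x * Re (Stieltjes1 h c (RtoC x)))).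
Proof.
intros Hc Hx Hd Hh. assert (E := Stieltjes1_real h c M x d Hc Hx Hd Hh).
unfold log_gamma. destruct (Stieltjes1 h c (RtoC x)) as [y z]. simpl in E. subst z.
unfold RtoC, Cmult, Re; simpl. f_equal; ring.
Qed.

Lemma Stieltjes2_real_pos h c M (r a : R) : 0 < c -> 0 < r -> c <= a ->
  (forall u, c <= u -> continuous h u /\ 0 <= h u <= M) ->
  (forall u, a < u -> 0 < h u) ->
  Im (Stieltjes2 h c (RtoC r)) = 0 /\ 0 < Re (Stieltjes2 h c (RtoC r)) /\
  r * Cmod (Stieltjes2 h c (RtoC r)) <= M.
Proof.
intros Hc Hr Hca Hh Ha.
assert (HI := is_Cint_Stieltjes2 h c M _ 1 Hc (away_pos c r Hc Hr) Hh).
assert (Hreal : forall u, c <= u ->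
  (RtoC (h u) / ((RtoC r + RtoC u) * (RtoC r + RtoC u)))%C
    = RtoC (h u / ((r + u) * (r + u)))).
{ intros u Hu. rewrite <- RtoC_plus, <- RtoC_mult, <- RtoC_div by nra. reflexivity. }
assert (HM : 0 <= M) by (destruct (Hh c); lra).
split; [|split].
- apply (is_Cint_Im_0 c _ _) with (2 := HI).
  intros u Hu. rewrite Hreal by trivial. apply im_RtoC.
- apply (is_Cint_ext c _ _ _ Hreal) in HI.
  set (g := fun u => h u / ((r + u) * (r + u))).
  assert (Hg : forall u, c <= u -> continuous g u).
  { intros u Hu. apply continuous_div; [nra|apply Hh; trivial|].
    apply (ex_derive_continuous (V := R_NormedModule)). auto_derive; trivial. }
  apply is_Cint_Re_lim in HI; [|intros u Hu; apply continuous_RtoC, Hg, Hu].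
  change (is_lim (fun X => RInt g c X) p_infty (Re (Stieltjes2 h c (RtoC r)))) in HI.
  (* Strict positivity has to survive the limit: [a, a + 1] contributes a fixed positive amount to
     every later partial integral, and that amount is the tolerance in the limit. *)
  assert (Hm : 0 < RInt g a (a + 1)).
  { apply RInt_gt_0; [lra| |].
    - intros u Hu. apply Rdiv_lt_0_compat; [apply Ha; lra|nra].
    - intros u Hu. apply Hg; lra. }
  apply is_lim_spec in HI. destruct (HI (mkposreal _ Hm)) as [X0 H].
  assert (H1 := Rmax_l X0 (a + 1)). assert (H2 := Rmax_r X0 (a + 1)).
  set (X := Rmax X0 (a + 1) + 1).
  assert (HXa : a + 1 < X) by (unfold X; lra).
  assert (HX0 : X0 < X) by (unfold X; lra). clearbody X.
  assert (HX : Rabs (RInt g c X - Re (Stieltjes2 h c (RtoC r))) < RInt g a (a + 1))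
    by exact (H X HX0).
  apply Rabs_lt_between in HX.
  assert (ex : forall x y, c <= x -> c <= y -> ex_RInt g x y).
  { intros x y Hx Hy. apply (ex_RInt_continuous (V := R_CompleteNormedModule)).
    intros z Hz. apply Hg. revert Hz; unfold Rmin; destruct Rle_dec; lra. }
  assert (Hp : forall x y, c <= x -> x <= y -> 0 <= RInt g x y).
  { intros x y Hx Hy. apply RInt_ge_0; trivial. apply ex; lra.
    intros u Hu. apply Rdiv_le_0_compat; [apply Hh; lra|nra]. }
  assert (C1 := RInt_Chasles (V := R_CompleteNormedModule) g c a X
    (ex c a ltac:(lra) ltac:(lra)) (ex a X ltac:(lra) ltac:(lra))).
  assert (C2 := RInt_Chasles (V := R_CompleteNormedModule) g a (a + 1) X
    (ex a (a + 1) ltac:(lra) ltac:(lra)) (ex (a + 1) X ltac:(lra) ltac:(lra))).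
  change (RInt g c a + RInt g a X = RInt g c X) in C1.
  change (RInt g a (a + 1) + RInt g (a + 1) X = RInt g a X) in C2.
  assert (P1 := Hp c a ltac:(lra) Hca).
  assert (P2 := Hp (a + 1) X ltac:(lra) ltac:(lra)). lra.
- assert (Hdom : dominator c (fun u => M * / ((r + u) * (r + u)))
    (fun u => M * - / (r + u)) (M * 0)).
  { apply dominator_scal; trivial. intros u Hu.
    split; [|split; [|split]].
    - left; apply Rinv_0_lt_compat; nra.
    - apply (ex_derive_continuous (V := R_NormedModule)). auto_derive. nra.
    - auto_derive; [lra|]. field; lra.
    - assert (0 < / (r + u)) by (apply Rinv_0_lt_compat; lra). lra. }
  assert (Hle : Cmod (Stieltjes2 h c (RtoC r)) <= M * 0 - M * - / (r + c)).
  { apply (is_Cint_le _ _ _ _ _ _ HI Hdom). intros u Hu.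
    rewrite Hreal, Cmod_R by trivial. destruct (Hh u Hu) as [_ Hhu].
    rewrite Rabs_pos_eq by (apply Rdiv_le_0_compat; nra).
    apply Rmult_le_compat_r; [left; apply Rinv_0_lt_compat; nra|lra]. }
  apply Rmult_le_compat_l with (r := r) in Hle; [|lra].
  eapply Rle_trans; [exact Hle|].
  replace (r * (M * 0 - M * - / (r + c))) with (M * (r / (r + c))) by (field; lra).
  rewrite <- (Rmult_1_r M) at 2. apply Rmult_le_compat_l; trivial.
  apply Rmult_le_reg_r with (r + c); [lra|].
  unfold Rdiv; rewrite Rmult_assoc, Rinv_l; lra.
Qed.

(* [eps(s) ~ h(|s|)] uniformly in sectors, where [k] measures the sector, and
   [r eps'(r) = o(h r)]. *)
Lemma eps_log_gamma_asymptotics h c M e : 0 < c -> 0 < e -> slowly_varying h ->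
  (forall u, 0 < u -> continuous h u /\ 0 <= h u <= M) ->
  (forall a, exists u, a < u /\ 0 < h u) ->
  exists r0, c <= r0 /\ forall r, r0 < r -> 0 < h r /\
    (forall s k, 0 < k <= 1 -> Cmod s = r ->
       (forall u, c <= u -> k * (r + u) <= Cmod (s + RtoC u)%C) ->
       Cmod (s * Stieltjes2 h c s - RtoC (h r))%C <= e / k ^ 2 * h r) /\
    r * Cmod (C_derive (eps (log_gamma h c)) (RtoC r)) <= e * h r.
Proof.
intros Hc He Hsv Hh Hpos.
assert (Hhc : forall u, c <= u -> continuous h u /\ 0 <= h u <= M)
  by (intros u Hu; apply Hh; lra).
destruct (slowly_varying_kernel h c M (e / 2) Hc ltac:(lra) Hsv
  (fun u Hu => proj2 (Hh u Hu)) Hpos) as [r1 [Hr1 H1]].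
(* Half of [e] goes to the kernel estimate; the other half covers the exact constant part, whose
   relative error is of order c/r, hence the demand c/r <= e/2. *)
exists (Rmax r1 (2 * c / e)).
assert (L1 := Rmax_l r1 (2 * c / e)). assert (L2 := Rmax_r r1 (2 * c / e)).
split; [lra|]. intros r Hr.
destruct (H1 r ltac:(lra)) as [Hhr K]. clear H1.
assert (Hcr : c / r <= e / 2).
{ assert (H : 2 * c / e < r) by lra.
  apply Rmult_lt_compat_r with (r := e) in H; trivial.
  unfold Rdiv in H. rewrite Rmult_assoc, Rinv_l in H by lra.
  apply Rmult_le_reg_r with r; [lra|].
  unfold Rdiv at 1. rewrite Rmult_assoc, Rinv_l; lra. }
split; [trivial|split].
- intros s k Hk Hsr Hs.
  assert (Haw : away c s k).
  { split; [lra|]. intros u Hu. eapply Rle_trans; [|apply Hs; trivial]. nra. }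
  assert (Hk2 : 0 < k ^ 2) by (apply pow_lt; lra).
  assert (HI := is_Cint_minus _ _ _ _ _ (is_Cint_Stieltjes2 h c M s k Hc Haw Hhc)
    (is_Cint_mult _ (RtoC (h r)) _ _ (is_Cint_inv_sqr c s k Hc Haw))).
  assert (B1 : Cmod (Stieltjes2 h c s - RtoC (h r) * / (s + RtoC c))%C
     <= / k ^ 2 * (e / 2 * h r / r)).
  { apply (K _ _ _) with (2 := HI); [left; apply Rinv_0_lt_compat; trivial|].
    intros u Hu. assert (N := away_neq_0 c s k u Hc Haw Hu).
    replace (RtoC (h u) / ((s + RtoC u) * (s + RtoC u))
      - RtoC (h r) * / ((s + RtoC u) * (s + RtoC u)))%C
     with (RtoC (h u - h r) / ((s + RtoC u) * (s + RtoC u)))%C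
     by (rewrite RtoC_minus; field; trivial).
    rewrite Cmod_div, Cmod_R, Cmod_mult by (apply Cmult_neq_0; trivial).
    replace (/ k ^ 2 * (Rabs (h u - h r) / (r + u) ^ 2))
      with (Rabs (h u - h r) * / (k * (r + u) * (k * (r + u)))) by (field; lra).
    apply Rmult_le_compat_l; [apply Rabs_pos|].
    specialize (Hs u Hu). assert (0 < k * (r + u)) by nra.
    apply Rinv_le_contravar; nra. }
  assert (N := away_neq_0 c s k c Hc Haw (Rle_refl c)).
  assert (B2 : Cmod (RtoC c / (s + RtoC c))%C <= e / 2 / k ^ 2).
  { rewrite Cmod_div, Cmod_R, Rabs_pos_eq by (trivial; lra).
    assert (Hs' := Hs c (Rle_refl c)). assert (0 < k * r) by nra.
    apply Rle_trans with (c / r / k).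
    - replace (c / r / k) with (c * / (k * r)) by (field; lra).
      apply Rmult_le_compat_l; [lra|]. apply Rinv_le_contravar; nra.
    - apply Rmult_le_reg_r with (k ^ 2); trivial.
      replace (c / r / k * k ^ 2) with (c / r * k) by (field; lra).
      replace (e / 2 / k ^ 2 * k ^ 2) with (e / 2) by (field; lra).
      assert (0 < c / r) by (apply Rdiv_lt_0_compat; lra). nra. }
  (* The integral with [h] replaced by h(r) is h(r)/(s + c), and s/(s + c) = 1 - c/(s + c). *)
  replace (s * Stieltjes2 h c s - RtoC (h r))%C
    with (s * (Stieltjes2 h c s - RtoC (h r) * / (s + RtoC c))
      - RtoC (h r) * (RtoC c / (s + RtoC c)))%C by (field; trivial).
  eapply Rle_trans; [apply Cmod_triangle|].
  rewrite Cmod_opp, !Cmod_mult, Cmod_R, Hsr, (Rabs_pos_eq (h r)) by lra.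
  apply Rmult_le_compat_l with (r := r) in B1; [|lra].
  apply Rmult_le_compat_l with (r := h r) in B2; [|lra].
  replace (e / k ^ 2 * h r) with
   (r * (/ k ^ 2 * (e / 2 * h r / r)) + h r * (e / 2 / k ^ 2)) by (field; lra).
  lra.
- assert (Haw := away_pos c r Hc ltac:(lra)).
  assert (Nr : RtoC r <> RtoC 0) by (intros E; apply RtoC_inj in E; lra).
  rewrite (is_Cderive_C_derive _ _ _ (is_Cderive_eps h c M _ 1 Hc Haw Nr Hhc)).
  (* eps'(r) is [Stieltjes2] - 2 r [Stieltjes3]. After subtraction of the constant part the
     integrand is (h u - h r)(u - r)/(r + u)^3, and |u - r| <= r + u brings it to the form of
     [slowly_varying_kernel] with K = 1. *)
  assert (HI := is_Cint_minus _ _ _ _ _ (is_Cint_plus _ _ _ _ _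
    (is_Cint_Stieltjes2 h c M _ 1 Hc Haw Hhc)
    (is_Cint_mult _ (RtoC (- 2 * r)) _ _ (is_Cint_Stieltjes3 h c M _ 1 Hc Haw Hhc)))
    (is_Cint_mult _ (RtoC (h r)) _ _
       (is_Cint_inv_sqr_sub_inv_cube c r Hc ltac:(lra)))).
  apply K with (K := 1) in HI; [|lra|].
  + set (Z := (Stieltjes2 h c (RtoC r)
       + RtoC (-2 * r) * Stieltjes3 h c (RtoC r))%C) in *.
    replace (1 * Stieltjes2 h c (RtoC r)
       + RtoC r * (RtoC (-2) * Stieltjes3 h c (RtoC r)))%C
     with (Z - RtoC (h r) * RtoC (c / (r + c) ^ 2)
       + RtoC (h r) * RtoC (c / (r + c) ^ 2))%C.
    2:{ unfold Z. rewrite (RtoC_mult (-2) r). ring. }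
    assert (T := Cmod_triangle (Z - RtoC (h r) * RtoC (c / (r + c) ^ 2))%C
       (RtoC (h r) * RtoC (c / (r + c) ^ 2))%C).
    assert (B : Cmod (RtoC (h r) * RtoC (c / (r + c) ^ 2))%C <= h r * (c / r ^ 2)).
    { rewrite <- RtoC_mult, Cmod_R, Rabs_pos_eq.
      - apply Rmult_le_compat_l; [lra|]. apply Rmult_le_compat_l; [lra|].
        apply Rinv_le_contravar; [apply pow_lt; lra|apply pow_incr; lra].
      - apply Rmult_le_pos; [lra|]. apply Rdiv_le_0_compat; [lra|apply pow_lt; lra]. }
    apply Rle_trans with (r * (1 * (e / 2 * h r / r) + h r * (c / r ^ 2))).
    * apply Rmult_le_compat_l; lra.
    * replace (r * (1 * (e / 2 * h r / r) + h r * (c / r ^ 2)))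
        with (e / 2 * h r + h r * (c / r)) by (field; lra). nra.
  + intros u Hu.
    match goal with |- Cmod ?t <= _ => replace t with
      (RtoC ((h u - h r) * ((u - r) / (r + u) ^ 3))) end.
    2:{ rewrite <- RtoC_plus, <- !RtoC_mult, <- !RtoC_div, <- RtoC_mult,
          <- RtoC_plus, <- RtoC_minus
          by (repeat apply Rmult_integral_contrapositive_currified; lra).
        f_equal. field. lra. }
    rewrite Cmod_R, Rabs_mult, Rmult_1_l.
    apply Rmult_le_compat_l; [apply Rabs_pos|].
    unfold Rdiv. rewrite Rabs_mult, (Rabs_pos_eq (/ _))
      by (left; apply Rinv_0_lt_compat, pow_lt; lra).
    replace (/ (r + u) ^ 2) with ((r + u) * / (r + u) ^ 3) by (field; lra).
    apply Rmult_le_compat_r; [left; apply Rinv_0_lt_compat, pow_lt; lra|].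
    apply Rabs_le; lra.
Qed.

(** * The theorem *)

(** A weakly increasing [l] may have flat stretches, but unboundedness forces growth beyond every
    point. This provides the starting point of Potter's bound. *)
Lemma Derive_pos_beyond l a : C1_nonneg l -> unboundedly_increasing l ->
  exists u, a < u /\ 0 < u /\ 0 < Derive l u.
Proof.
intros HC [Hmono Hunb].
set (b := Rmax a 1 + 1).
assert (Hb : a < b /\ 1 < b).
{ unfold b. generalize (Rmax_l a 1) (Rmax_r a 1). lra. }
destruct (Hunb (l b)) as [x [Hx0 Hx]].
assert (Hbx : b < x).
{ destruct (Rlt_le_dec b x) as [H|H]; trivial.
  specialize (Hmono x b Hx0 H). lra. }
destruct (MVT_gen l b x (Derive l)) as [t [Ht Hd]].
- rewrite Rmin_left, Rmax_right by lra. intros t Ht.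
  apply Derive_correct. apply (C1_nonneg_Derive l t HC); lra.
- rewrite Rmin_left, Rmax_right by lra. intros t Ht.
  apply continuity_pt_filterlim, (ex_derive_continuous (V := R_NormedModule) l).
  apply (C1_nonneg_Derive l t HC); lra.
- rewrite Rmin_left, Rmax_right in Ht by lra.
  exists t. split; [lra|split; [lra|]]. nra.
Qed.

Lemma RInt_rho_dlog l c r : C1_nonneg l -> (forall x, 0 <= x -> 0 < l x) ->
  0 < c -> c <= r -> RInt (fun u => rho_dlog l u / u) c r = ln (l r) - ln (l c).
Proof.
intros HC Hl Hc Hr.
rewrite (RInt_ext (V := R_CompleteNormedModule) _ (fun u => Derive l u / l u)).
2:{ rewrite Rmin_left by lra. intros u Hu. unfold rho_dlog.
    change (u * (Derive l u / l u) / u = Derive l u / l u). field.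
    split; [|lra]. apply Rgt_not_eq, Hl; lra. }
apply is_RInt_unique.
apply (is_RInt_derive (V := R_CompleteNormedModule) (fun u => ln (l u)));
  rewrite Rmin_left, Rmax_right by lra; intros u Hu;
  destruct (C1_nonneg_Derive l u HC ltac:(lra)) as [H1 H2];
  assert (Hlu := Hl u ltac:(lra)).
- auto_derive; [tauto|].
  change (Derive (fun x => l x) u) with (Derive l u). field. lra.
- apply continuous_div; [lra|trivial|].
  apply (ex_derive_continuous (V := R_NormedModule) l); trivial.
Qed.

Lemma ln_unbounded l T : (forall x, 0 <= x -> 0 < l x) ->
  unboundedly_increasing l -> exists X0, 0 <= X0 /\ forall X, X0 < X -> T < ln (l X).
Proof.
intros Hl [Hmono Hunb].
destruct (Hunb (exp T)) as [x [Hx0 Hx]].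
exists x. split; trivial. intros X HX.
rewrite <- (ln_exp T). apply ln_increasing; [apply exp_pos|].
specialize (Hmono x X Hx0 ltac:(lra)). lra.
Qed.

Lemma gamma_eq l c M s d : (forall x, 0 <= x -> 0 < l x) -> 0 < c -> away c s d ->
  (forall u, c <= u -> continuous (rho_dlog l) u /\ 0 <= rho_dlog l u <= M) ->
  gamma l c s = Cexp (log_gamma (rho_dlog l) c s).
Proof.
intros Hl Hc Hs Hh. unfold gamma, log_gamma. f_equal. f_equal.
apply RInt_gen_Cint.
apply (is_Cint_ext c) with (2 := is_Cint_Stieltjes1 (rho_dlog l) c M s d Hc Hs Hh).
intros u Hu. f_equal. f_equal. unfold rho_dlog. field.
split; [|lra]. apply Rgt_not_eq, Hl; lra.
Qed.

Theorem theorem3 :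
  forall l : R -> R,
    (forall x : R, 0 <= x -> 0 < l x) ->
    C1_nonneg l ->
    unboundedly_increasing l ->
    slowly_varying (rho_dlog l) ->
    (exists M : R, forall r : R, 0 < r -> Rabs (rho_dlog l r) <= M) ->
    forall c : R, 0 < c ->
      admissible PI c (gamma l c) /\
      is_lim (fun r : R => ln (Re (gamma l c (RtoC r))) / (r * ln (l r)))
        p_infty 1 /\
      (ex_finite_lim (rho_dlog l) p_infty ->
       is_lim (fun r : R => l r / Rpower (Re (gamma l c (RtoC r))) (1 / r))
         p_infty (l c)).
Proof.
intros l Hl HC Hinc Hsv [M HM] c Hc.
set (h := rho_dlog l) in *.
assert (Hh0 : forall u, 0 < u -> continuous h u /\ 0 <= h u <= M).
{ intros u Hu. destruct (C1_nonneg_Derive l u HC Hu) as [H1 H2].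
  assert (Hlu := Hl u ltac:(lra)). split.
  - apply (continuous_mult (K := R_AbsRing) (fun u => u)); [apply continuous_id|].
    apply continuous_div; [lra|trivial|].
    apply (ex_derive_continuous (V := R_NormedModule) l); trivial.
  - assert (H3 := Derive_nonneg_of_increasing l u Hu H1 (proj1 Hinc)).
    specialize (HM u Hu). apply Rabs_le_between in HM. split; [|lra].
    apply Rmult_le_pos; [lra|]. apply Rdiv_le_0_compat; lra. }
assert (Hh : forall u, c <= u -> continuous h u /\ 0 <= h u <= M)
  by (intros u Hu; apply Hh0; lra).
assert (Hpos : forall a, exists u, a < u /\ 0 < h u).
{ intros a. destruct (Derive_pos_beyond l a HC Hinc) as (u & H1 & H2 & H3).
  exists u. split; trivial. assert (Hlu := Hl u ltac:(lra)).
  apply Rmult_lt_0_compat; trivial. apply Rdiv_lt_0_compat; trivial. }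
assert (HM0 : 0 <= M) by (destruct (Hh c); lra).
assert (Hasy := fun e He => eps_log_gamma_asymptotics h c M e Hc He Hsv Hh0 Hpos).
(* The tolerance 1 is arbitrary: only the positivity of [h] beyond [a] is extracted. *)
destruct (Hasy 1 Rlt_0_1) as [a [Hca Ha]].
assert (Hha : forall u, a < u -> 0 < h u) by (intros u Hu; apply Ha; trivial).
clear Ha.
(* [P r] is log L(r) = log gamma(r) / r for r > 0. *)
set (P := fun r : R => r * Re (Stieltjes1 h c (RtoC r))).
assert (Nr : forall r : R, 0 < r -> RtoC r <> RtoC 0).
{ intros r Hr E; apply RtoC_inj in E; lra. }
assert (Heps : forall r : R, 0 < r ->
  eps (log_gamma h c) (RtoC r) = (RtoC r * Stieltjes2 h c (RtoC r))%C).
{ intros r Hr. apply (eps_log_gamma h c M _ 1); auto using away_pos. }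
assert (Hgam : forall r : R, 0 < r -> gamma l c (RtoC r) = RtoC (exp (r * P r))).
{ intros r Hr. rewrite (gamma_eq l c M _ 1) by auto using away_pos.
  fold h. rewrite (log_gamma_real h c M r 1) by (auto using away_pos; lra).
  apply Cexp_real. }
assert (HPlog : forall a e B r, c <= r -> 0 <= e -> 0 <= B ->
  (forall u, c <= u -> Rabs (h u - a) <= e + B / u ^ 2) ->
  Rabs (P r - (ln (l r) - ln (l c)) - a * ln ((r + c) / r))
    <= 2 * e + 2 * B / (r * c)).
{ intros b e B r Hr He HB Hb.
  rewrite <- (RInt_rho_dlog l c r) by trivial.
  apply (Stieltjes_log_bound h c b e B r); trivial.
  - intros u Hu; apply Hh, Hu.
  - apply (is_Cint_Stieltjes1 h c M _ 1); trivial. apply away_pos; lra. }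
(* The comparison with a = 0, e = M and B = 0, which needs nothing but 0 <= h <= M. *)
assert (HP2M : forall r, c <= r -> Rabs (P r - (ln (l r) - ln (l c))) <= 2 * M).
{ intros r Hr.
  assert (H := HPlog 0 M 0 r Hr HM0 (Rle_refl 0)).
  replace (2 * M + 2 * 0 / (r * c)) with (2 * M) in H by (field; lra).
  replace (P r - (ln (l r) - ln (l c)) - 0 * ln ((r + c) / r))
    with (P r - (ln (l r) - ln (l c))) in H by ring.
  apply H. intros u Hu. destruct (Hh u Hu) as [_ Hhu].
  rewrite Rabs_pos_eq by lra. unfold Rdiv; rewrite Rmult_0_l; lra. }
split; [|split].
- assert (HPI := PI_RGT_0).
  split; [lra|]. split; [trivial|]. split; [|split; [|split]].
  + intros s Hs. destruct (angle_away c s Hc Hs) as [d Hd].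
    assert (H := is_Cderive_comp Cexp (log_gamma h c) s _ _ (is_Cderive_Cexp _)
       (is_Cderive_log_gamma h c M s d Hc Hd Hh)).
    eexists. refine (is_Cderive_ext_loc _ _ _ _ (d * c / 2) _ _ H).
    * assert (Hd0 := proj1 Hd). nra.
    * intros w Hw. symmetry. apply (gamma_eq l c M w (d / 2)); trivial.
      apply (away_near c w d s); trivial.
  + intros s Hs. destruct (angle_away c s Hc Hs) as [d Hd].
    rewrite (gamma_eq l c M s d) by trivial. apply Cexp_neq_0.
  + intros x Hx. destruct (away_real c x Hc Hx) as [d Hd].
    rewrite (gamma_eq l c M _ d) by trivial. fold h.
    rewrite (log_gamma_real h c M x d), Cexp_real by trivial.
    split; [reflexivity|apply exp_pos].
  + exists (log_gamma h c). split; [|split; [|split; [|split; [|split]]]].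
    * split; [|split].
      -- intros s Hs. destruct (angle_away c s Hc Hs) as [d Hd].
         eexists. apply (is_Cderive_log_gamma h c M s d); trivial.
      -- intros s Hs. destruct (angle_away c s Hc Hs) as [d Hd].
         symmetry. apply (gamma_eq l c M s d); trivial.
      -- intros x Hx. destruct (away_real c x Hc Hx) as [d Hd].
         rewrite (log_gamma_real h c M x d) by trivial. reflexivity.
    * intros r Hr. rewrite Heps by trivial. rewrite im_scal_l, re_scal_l.
      destruct (Stieltjes2_real_pos h c M r a Hc Hr Hca Hh Hha) as (E1 & E2 & _).
      rewrite E1. split; [ring|]. apply Rmult_lt_0_compat; trivial.
    * exists M. intros r Hr. rewrite Heps, re_scal_l by trivial.
      destruct (Stieltjes2_real_pos h c M r a Hc Hr Hca Hh Hha) as (_ & _ & E3).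
      eapply Rle_trans; [|exact E3]. apply Rmult_le_compat_l; [lra|].
      eapply Rle_trans; [apply Rle_abs|apply re_le_Cmod].
    (* Condition (A): eps(r)/r is the derivative of [P], so the integral is P(X) - P(1), and [P]
       differs from ln l, which is unbounded, by a bounded quantity. *)
    * assert (HdP : forall r, 0 < r -> is_derive P r (Re (Stieltjes2 h c (RtoC r)))).
      { intros r Hr.
        assert (H := is_Cderive_Re _ _ _
          (is_Cderive_Stieltjes1 h c M _ 1 Hc (away_pos c r Hc Hr) Hh)).
        apply (is_derive_ext (V := R_NormedModule)) with (2 := H).
        intros t. apply re_scal_l. }
      assert (HRI : forall X, 1 <= X ->
        RInt (fun r => Re (eps (log_gamma h c) (RtoC r)) / r) 1 X = P X - P 1).
      { intros X HX.
        rewrite (RInt_ext (V := R_CompleteNormedModule) _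
          (fun r => Re (Stieltjes2 h c (RtoC r)))).
        2:{ rewrite Rmin_left by lra. intros r Hr.
            rewrite Heps, re_scal_l by lra.
            set (t := Re (Stieltjes2 h c (RtoC r))).
            change (r * t / r = t). field; lra. }
        apply is_RInt_unique.
        apply (is_RInt_derive (V := R_CompleteNormedModule) P);
          rewrite Rmin_left, Rmax_right by lra; intros r Hr.
        - apply HdP; lra.
        - apply (ex_derive_continuous (V := R_NormedModule)
            (fun r : R => Re (Stieltjes2 h c (RtoC r)))).
          eexists. apply is_Cderive_Re.
          apply (is_Cderive_Stieltjes2 h c M _ 1); trivial.
          apply away_pos; lra. }
      apply is_lim_spec. intros T.
      destruct (ln_unbounded l (T + P 1 + ln (l c) + 2 * M) Hl Hinc) as [X0 [H0 HX0]].
      exists (Rmax X0 (Rmax c 1)). intros X HX.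
      assert (L1 := Rmax_l X0 (Rmax c 1)). assert (L2 := Rmax_r X0 (Rmax c 1)).
      assert (L3 := Rmax_l c 1). assert (L4 := Rmax_r c 1).
      rewrite HRI by lra.
      assert (H1 := HP2M X ltac:(lra)). apply Rabs_le_between in H1.
      specialize (HX0 X ltac:(lra)). lra.
    * intros e.
      (* Condition (B): 1/2 ensures eps(r) >= h(r)/2, and e/2 then converts e h(r)/2 into e
         eps(r). *)
      assert (He : 0 < Rmin (/ 2) (e / 2)).
      { apply Rmin_glb_lt; [lra|]. assert (H := cond_pos e). lra. }
      destruct (Hasy _ He) as [r0 [Hr0 H]].
      exists r0. intros r Hr. destruct (H r Hr) as (Hhr & HE & HD).
      change (Rabs (r * Cmod (C_derive (eps (log_gamma h c)) (RtoC r)))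
        <= e * Rabs (Re (eps (log_gamma h c) (RtoC r)))).
      assert (HE1 := HE (RtoC r) 1 ltac:(lra)).
      rewrite Cmod_R, Rabs_pos_eq in HE1 by lra.
      specialize (HE1 eq_refl).
      specialize (HE1 ltac:(intros u Hu; rewrite <- RtoC_plus, Cmod_R, Rabs_pos_eq; lra)).
      rewrite <- Heps in HE1 by lra.
      assert (Hmin1 := Rmin_l (/ 2) (e / 2)). assert (Hmin2 := Rmin_r (/ 2) (e / 2)).
      set (m := Rmin (/ 2) (e / 2)) in *.
      replace (m / 1 ^ 2 * h r) with (m * h r) in HE1 by field.
      assert (HR := Rle_trans _ _ _ (re_le_Cmod _) HE1).
      replace (Re (eps (log_gamma h c) (RtoC r) - RtoC (h r)))
        with (Re (eps (log_gamma h c) (RtoC r)) - h r) in HR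
        by (unfold Re; simpl; ring).
      apply Rabs_le_between in HR.
      assert (h r / 2 <= Re (eps (log_gamma h c) (RtoC r))) by nra.
      rewrite Rabs_pos_eq by (apply Rmult_le_pos; [lra|apply Cmod_ge_0]).
      rewrite Rabs_pos_eq by lra.
      assert (He0 := cond_pos e).
      apply Rle_trans with (e / 2 * h r); [nra|].
      apply Rle_trans with (e * (h r / 2)); [lra|].
      apply Rmult_le_compat_l; lra.
    * intros delta Hdelta eta Heta.
      destruct (Rle_lt_dec delta PI) as [HdPI|HdPI].
      (* For delta > PI no theta satisfies the sector condition. *)
      2:{ exists 0. intros r theta _ Ht. generalize (Rabs_pos theta). lra. }
      set (k := (1 - cos delta) / 2).
      assert (Hk : 0 < k <= 1).
      { assert (cos delta < 1).
        { rewrite <- cos_0. apply cos_decreasing_1; lra. }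
        generalize (COS_bound delta). unfold k. lra. }
      assert (Hk2 : 0 < k ^ 2 <= 1) by (split; [apply pow_lt; lra|nra]).
      (* Condition (C): the errors at s and at r are each at most eta h(r)/4, the factor k^2 paying
         for the sector; their sum eta h(r)/2 is at most eta |eps(r)|, by the choice of 1/2. *)
      assert (He : 0 < Rmin (/ 2) (eta * k ^ 2 / 4)).
      { apply Rmin_glb_lt; [lra|]. apply Rdiv_lt_0_compat; nra. }
      destruct (Hasy _ He) as [r0 [Hr0 H]].
      exists r0. intros r theta Hr Ht. destruct (H r Hr) as (Hhr & HE & _).
      assert (Hmin1 := Rmin_l (/ 2) (eta * k ^ 2 / 4)).
      assert (Hmin2 := Rmin_r (/ 2) (eta * k ^ 2 / 4)).
      set (m := Rmin (/ 2) (eta * k ^ 2 / 4)) in *.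
      assert (HE1 := HE (RtoC r) 1 ltac:(lra)).
      rewrite Cmod_R, Rabs_pos_eq in HE1 by lra.
      specialize (HE1 eq_refl).
      specialize (HE1 ltac:(intros u Hu; rewrite <- RtoC_plus, Cmod_R, Rabs_pos_eq; lra)).
      rewrite <- Heps in HE1 by lra.
      replace (m / 1 ^ 2 * h r) with (m * h r) in HE1 by field.
      set (s := (RtoC r * Cexp (Ci * RtoC theta))%C) in *.
      assert (Hsec : forall u, c <= u -> k * (r + u) <= Cmod (s + RtoC u)%C).
      { intros u Hu. apply Cmod_sector_shift_ge; lra. }
      assert (Hsr : Cmod s = r).
      { unfold s. rewrite Cmod_mult, Cmod_R, Rabs_pos_eq by lra.
        unfold Cmod, Cexp, Re, Im; simpl.
        replace (0 * theta - 1 * 0) with 0 by ring. rewrite exp_0.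
        set (t := 0 * 0 + 1 * theta).
        replace (1 * cos t * (1 * cos t * 1) + 1 * sin t * (1 * sin t * 1))
          with (Rsqr (sin t) + Rsqr (cos t)) by (unfold Rsqr; ring).
        rewrite sin2_cos2, sqrt_1. ring. }
      assert (HE2 := HE s k Hk Hsr Hsec).
      assert (Haw : away c s k).
      { split; [lra|]. intros u Hu. eapply Rle_trans; [|apply Hsec; trivial]. nra. }
      assert (Hs0 : s <> RtoC 0) by (apply Cmod_gt_0; lra).
      rewrite <- (eps_log_gamma h c M s k Hc Haw Hs0 Hh) in HE2.
      set (Es := eps (log_gamma h c) s) in *.
      set (Er := eps (log_gamma h c) (RtoC r)) in *.
      assert (HEr : h r / 2 <= Cmod Er).
      { assert (T := Cmod_triangle Er (- (Er - RtoC (h r)))%C).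
        rewrite Cmod_opp in T.
        replace (Er + - (Er - RtoC (h r)))%C with (RtoC (h r)) in T by ring.
        rewrite Cmod_R, Rabs_pos_eq in T by lra. nra. }
      assert (HEr0 : Er <> RtoC 0) by (apply Cmod_gt_0; lra).
      replace (Es / Er - RtoC 1)%C with
        (((Es - RtoC (h r)) + - (Er - RtoC (h r))) / Er)%C by (field; trivial).
      rewrite Cmod_div by trivial.
      assert (T := Cmod_triangle (Es - RtoC (h r))%C (- (Er - RtoC (h r)))%C).
      rewrite Cmod_opp in T.
      apply Rmult_le_reg_r with (Cmod Er); [lra|].
      unfold Rdiv. rewrite Rmult_assoc, Rinv_l, Rmult_1_r by lra.
      assert (Hm1 : m / k ^ 2 <= eta / 4).
      { apply Rmult_le_reg_r with (k ^ 2); [lra|].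
        unfold Rdiv at 1. rewrite Rmult_assoc, Rinv_l by lra. lra. }
      assert (Hm2 : m <= eta / 4) by nra.
      assert (m / k ^ 2 * h r <= eta / 4 * h r) by (apply Rmult_le_compat_r; lra).
      assert (m * h r <= eta / 4 * h r) by (apply Rmult_le_compat_r; lra).
      assert (eta * (h r / 2) <= eta * Cmod Er) by (apply Rmult_le_compat_l; lra).
      lra.
- apply is_lim_spec. intros e.
  assert (He := cond_pos e).
  (* The quotient is P(r)/ln l(r), whose distance from 1 is at most (2 M + |ln l(c)|)/ln l(r). *)
  destruct (ln_unbounded l ((2 * M + Rabs (ln (l c))) / e) Hl Hinc) as [X0 [H0 HX0]].
  exists (Rmax X0 c). intros r Hr.
  assert (L1 := Rmax_l X0 c). assert (L2 := Rmax_r X0 c).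
  rewrite Hgam, re_RtoC, ln_exp by lra.
  specialize (HX0 r ltac:(lra)).
  assert (HlM : 0 <= (2 * M + Rabs (ln (l c))) / e).
  { apply Rdiv_le_0_compat; trivial. generalize (Rabs_pos (ln (l c))); lra. }
  replace (r * P r / (r * ln (l r)) - 1)
    with ((P r - (ln (l r) - ln (l c)) + - ln (l c)) / ln (l r)) by (field; lra).
  unfold Rdiv. rewrite Rabs_mult, (Rabs_pos_eq (/ _))
    by (left; apply Rinv_0_lt_compat; lra).
  apply Rmult_lt_reg_r with (ln (l r)); [lra|].
  rewrite Rmult_assoc, Rinv_l, Rmult_1_r by lra.
  eapply Rle_lt_trans; [apply Rabs_triang|]. rewrite Rabs_Ropp.
  assert (H1 := HP2M r ltac:(lra)).
  apply Rmult_lt_compat_l with (r := e) in HX0; trivial.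
  replace (e * ((2 * M + Rabs (ln (l c))) / e)) with (2 * M + Rabs (ln (l c))) in HX0
    by (field; lra).
  lra.
- intros [b Hb]. apply is_lim_spec in Hb.
  assert (Hlim : is_lim (fun r => ln (l r) - P r) p_infty (ln (l c))).
  { apply is_lim_spec. intros e. assert (He := cond_pos e).
    destruct (Hb (mkposreal (e / 8) ltac:(lra))) as [R1 HR1]; simpl in HR1.
    set (R2 := Rmax R1 c + 1).
    assert (HR2 : R1 < R2 /\ c < R2).
    { unfold R2. generalize (Rmax_l R1 c) (Rmax_r R1 c). lra. }
    (* Up to [R1] the deviation |h - b| is only known to be at most M + |b|; this [B] makes B/u^2
       exceed that bound there, while beyond [R1] the term e/8 suffices. *)
    set (B := (M + Rabs b) * R2 ^ 2).
    assert (HMb : 0 <= M + Rabs b) by (generalize (Rabs_pos b); lra).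
    assert (HB : 0 <= B) by (apply Rmult_le_pos; [trivial|apply pow2_ge_0]).
    assert (Hhb : forall u, c <= u -> Rabs (h u - b) <= e / 8 + B / u ^ 2).
    { intros u Hu. assert (Hu2 : 0 < u ^ 2) by (apply pow_lt; lra).
      assert (0 <= B / u ^ 2) by (apply Rdiv_le_0_compat; trivial).
      destruct (Rlt_le_dec R1 u) as [H1|H1].
      - specialize (HR1 u H1). lra.
      - assert (M + Rabs b <= B / u ^ 2).
        { apply Rmult_le_reg_r with (u ^ 2); trivial.
          unfold Rdiv. rewrite Rmult_assoc, Rinv_l, Rmult_1_r by lra.
          unfold B. apply Rmult_le_compat_l; trivial. apply pow_incr; lra. }
        destruct (Hh u Hu) as [_ Hhu].
        apply Rle_trans with (M + Rabs b); [|lra].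
        unfold Rminus. eapply Rle_trans; [apply Rabs_triang|].
        rewrite Rabs_Ropp, Rabs_pos_eq; lra. }
    (* Beyond [X0] both 2 B/(r c) and |b| ln ((r + c)/r) <= |b| c/r are at most e/4; with 2 e/8 the
       total is 3 e/4 < e. *)
    set (X0 := (8 * B / c + 4 * Rabs b * c) / e).
    exists (Rmax c X0). intros r Hr.
    assert (L1 := Rmax_l c X0). assert (L2 := Rmax_r c X0).
    assert (HX : 8 * B / c + 4 * Rabs b * c < e * r).
    { assert (HX : X0 < r) by lra. apply Rmult_lt_compat_l with (r := e) in HX; trivial.
      unfold X0 in HX.
      replace (e * ((8 * B / c + 4 * Rabs b * c) / e))
        with (8 * B / c + 4 * Rabs b * c) in HX by (field; lra). exact HX. }
    assert (Hbc : 0 <= Rabs b * c) by (apply Rmult_le_pos; [apply Rabs_pos|lra]).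
    assert (HBc : 0 <= B / c) by (apply Rdiv_le_0_compat; lra).
    assert (HB1 : 2 * B / (r * c) <= e / 4).
    { apply Rmult_le_reg_r with r; [lra|].
      replace (2 * B / (r * c) * r) with (2 * (B / c)) by (field; lra).
      replace (8 * B / c) with (8 * (B / c)) in HX by (field; lra). lra. }
    assert (Hln : Rabs (b * ln ((r + c) / r)) <= e / 4).
    { assert (Hcr : 0 < c / r) by (apply Rdiv_lt_0_compat; lra).
      replace ((r + c) / r) with (1 + c / r) by (field; lra).
      assert (E1 : 0 <= ln (1 + c / r)).
      { rewrite <- ln_1. apply ln_le; lra. }
      assert (E2 : ln (1 + c / r) <= c / r).
      { apply Rle_trans with (ln (exp (c / r))); [|rewrite ln_exp; lra].
        apply ln_le; [lra|apply exp_ineq1_le]. }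
      rewrite Rabs_mult, (Rabs_pos_eq (ln _)) by trivial.
      apply Rle_trans with (Rabs b * (c / r)).
      - apply Rmult_le_compat_l; trivial. apply Rabs_pos.
      - apply Rmult_le_reg_r with r; [lra|].
        replace (Rabs b * (c / r) * r) with (Rabs b * c) by (field; lra).
        replace (8 * B / c) with (8 * (B / c)) in HX by (field; lra). lra. }
    assert (H := HPlog b (e / 8) B r ltac:(lra) ltac:(lra) HB Hhb).
    apply Rabs_le_between in H. apply Rabs_le_between in Hln.
    apply Rabs_lt_between. lra. }
  apply (is_lim_ext_loc (fun r => exp (ln (l r) - P r))).
  { exists c. intros r Hr. rewrite Hgam, re_RtoC by lra.
    unfold Rpower. rewrite ln_exp.
    replace (1 / r * (r * P r)) with (P r) by (field; lra).
    unfold Rminus. rewrite exp_plus, exp_Ropp, exp_ln by (apply Hl; lra).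
    reflexivity. }
  rewrite <- (exp_ln (l c)) by (apply Hl; lra).
  exact (filterlim_comp _ _ _ (fun r => ln (l r) - P r) exp _ _ _ Hlim
    (continuous_exp (ln (l c)))).
Qed.
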